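(* Let $G$ be a finite simple graph with vertex set $I=\{\alpha_1,\dots,\alpha_n\}$ and let $\mathbf{k}\in\mathbb{Z}_+^n$. Then $$\widetilde{\pi}^G_{\mathbf{k}}(q)=\sum_{\mathbf{J}\in L_G(\mathbf{k})}\operatorname{chrmult}(\mathbf{J})\,q^{|\mathbf{J}|},$$ where $|\mathbf{J}|$ is the number of parts of $\mathbf{J}$ (counted with multiplicity).
   Context: $\mathbb{Z}_+$ denotes the non-negative integers. For $\mathbf{k}=(k_1,\dots,k_n)\in\mathbb{Z}_+^n$, $\operatorname{ht}\mathbf{k}=\sum_i k_i$. The generalized $\mathbf{k}$-chromatic polynomial $\pi^G_{\mathbf{k}}(q)$ is the polynomial whose value at a positive integer $q$ is the number of assignments to each vertex $\alpha_i$ of a set of exactly $k_i$ colors from $\{1,\dots,q\}$ such that adjacent vertices receive disjoint color sets; $\widetilde{\pi}^G_{\mathbf{k}}(q):=(-1)^{\operatorname{ht}\mathbf{k}}\pi^G_{\mathbf{k}}(-q)$. The bond lattice $L_G(\mathbf{k})$ is the set of finite multisets $\mathbf{J}=\{J_1,\dots,J_k\}$ of parts (written so that $\min J_1\ge\dots\ge\min J_k$ in the order $\alpha_1<\dots<\alpha_n$) such that each $J_i$ is a nonempty multiset of elements of $I$ whose underlying set induces a connected subgraph of $G$, and the multiset union $J_1\dot\cup\cdots\dot\cup J_k$ is the multiset in which each $\alpha_i$ occurs exactly $k_i$ times. The weight $\operatorname{wt}J_i\in\mathbb{Z}_+^n$ counts the occurrences of each $\alpha_j$ in $J_i$. The free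 partially commutative Lie algebra $\mathcal{L}(G)$ is the free Lie algebra over $\mathbb{C}$ on $I$ modulo the ideal generated by $[\alpha_i,\alpha_j]$ for all $\{\alpha_i,\alpha_j\}\notin E(G)$; it is $\mathbb{Z}_+^n$-graded, with $\mathcal{L}_{\mathbf{m}}(G)$ its grade space of degree $\mathbf{m}$, and $\operatorname{mult}\mathbf{m}:=\dim\mathcal{L}_{\mathbf{m}}(G)$. For nonzero $\mathbf{m}\in\mathbb{Z}_+^n$, $\operatorname{chrmult}(\mathbf{m}):=\sum_{\ell}\frac{\operatorname{mult}(\mathbf{m}/\ell)}{\ell}$, the sum over positive integers $\ell$ dividing every entry of $\mathbf{m}$. If the distinct parts of $\mathbf{J}\in L_G(\mathbf{k})$ are $J_1,\dots,J_r$, with $J_i$ occurring $m_i$ times and having weight $\mathbf{m}_i$, then $\operatorname{chrmult}(\mathbf{J}):=\prod_{i=1}^r\frac{1}{m_i!}\big(\operatorname{chrmult}(\mathbf{m}_i)\big)^{m_i}$. *)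

(* Defs.v *)
From HB Require Import structures.
From mathcomp Require Import all_boot all_order all_algebra.
From mathcomp Require Import generic_quotient ring_quotient finmap multiset.
From mathcomp Require Import boolp classical_sets cardinality fsbigop reals complex.
From mathcomp.multinomials Require Import monalg.

Set Implicit Arguments.
Unset Strict Implicit.
Unset Printing Implicit Defensive.

Import Order.TTheory GRing.Theory Num.Theory.
Local Open Scope mset_scope.
Local Open Scope quotient_scope.
Local Open Scope ring_scope.

Section Dimension.
Variables (K : fieldType) (V : lmodType K).

Definition lin_comb (s : seq V) (c : nat -> K) : V :=
  \sum_(i < size s) c i *: s`_i.

Definition lin_span (s : seq V) : set V := [set v | exists c, v = lin_comb s c]%classic.

Definition lin_free (s : seq V) : Prop :=
  forall c, lin_comb s c = 0 -> forall i, (i < size s)%N -> c i = 0.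

Definition is_basis (U : set V) (s : seq V) : Prop :=
  lin_free s /\ lin_span s = U.

(* The cardinality of a basis of U; the default 0 is only taken when U has no
   finite basis. *)
Definition dimension (U : set V) : nat :=
  xget 0%N [set d | exists2 s, is_basis U s & size s = d]%classic.

Lemma lin_comb_cons x s c :
  lin_comb (x :: s) c = c 0%N *: x + lin_comb s (fun i => c i.+1).
Proof. by rewrite /lin_comb /= big_ord_recl. Qed.

Lemma lin_span0 s : lin_span s 0.
Proof.
by exists (fun=> 0); rewrite /lin_comb big1 // => i _; rewrite scale0r.
Qed.

Lemma lin_spanD s x y : lin_span s x -> lin_span s y -> lin_span s (x + y).
Proof.
move=> [c ->] [d ->]; exists (fun i => c i + d i); rewrite /lin_comb -big_split.
by apply: eq_bigr => i _; rewrite scalerDl.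
Qed.

Lemma lin_spanZ s a x : lin_span s x -> lin_span s (a *: x).
Proof.
move=> [c ->]; exists (fun i => a * c i); rewrite /lin_comb scaler_sumr.
by apply: eq_bigr => i _; rewrite scalerA.
Qed.

Lemma mem_lin_span s x : x \in s -> lin_span s x.
Proof.
move=> xs; exists (fun j : nat => (j == index x s)%:R).
have xs' : (index x s < size s)%N by rewrite index_mem.
rewrite /lin_comb (bigD1 (Ordinal xs')) //= eqxx scale1r nth_index //.
rewrite big1 ?addr0 // => j jNi; rewrite (_ : (_ == _) = false) ?scale0r //.
exact: negbTE.
Qed.

Lemma lin_span_min s (U : set V) : U 0 -> (forall x y, U x -> U y -> U (x + y)) ->
  (forall a x, U x -> U (a *: x)) -> (forall x, x \in s -> U x) ->
  (lin_span s `<=` U)%classic.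
Proof.
move=> U0 UD UZ Us x [c ->]; apply: (big_ind U) => // i _.
by apply/UZ/Us/mem_nth.
Qed.

Lemma is_basis_span s : exists b, is_basis (lin_span s) b.
Proof.
elim: s => [|x s [b [fb sb]]]; first by exists [::].
have [[c xE]|xNb] := pselect (lin_span b x).
  exists b; split=> //; rewrite sb; apply/seteqP; split=> v.
    move=> [d ->]; exists (fun i => if i is j.+1 then d j else 0).
    by rewrite lin_comb_cons scale0r add0r.
  move=> [d ->]; rewrite lin_comb_cons -sb.
  have: lin_span s (lin_comb s (fun i => d i.+1)) by eexists.
  rewrite -sb => -[d' ->]; exists (fun i => d 0%N * c i + d' i).
  rewrite xE /lin_comb scaler_sumr -big_split.
  by apply: eq_bigr => i _; rewrite scalerDl scalerA.
exists (x :: b); split=> [c|].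
  rewrite lin_comb_cons => E.
  have c0 : c 0%N = 0.
    apply: contra_notP xNb => /eqP c0.
    exists (fun i => - (c 0%N)^-1 * c i.+1).
    transitivity (- (c 0%N)^-1 *: lin_comb b (fun i => c i.+1)); last first.
      by rewrite /lin_comb scaler_sumr; apply: eq_bigr => i _; rewrite scalerA.
    move/eqP: E; rewrite addrC addr_eq0 => /eqP->.
    by rewrite scalerN scaleNr opprK scalerA mulVf // scale1r.
  move: E; rewrite c0 scale0r add0r => /fb cb [//|i] /=; exact: cb.
apply/seteqP; split=> v [c ->]; rewrite lin_comb_cons.
  have: lin_span b (lin_comb b (fun i => c i.+1)) by eexists.
  rewrite sb => -[d ->]; exists (fun i => if i is j.+1 then d j else c 0%N).
  by rewrite lin_comb_cons.
have: lin_span s (lin_comb s (fun i => c i.+1)) by eexists.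
rewrite -sb => -[d ->]; exists (fun i => if i is j.+1 then d j else c 0%N).
by rewrite lin_comb_cons.
Qed.

Lemma lin_free_size s t :
  lin_free s -> (lin_span s `<=` lin_span t)%classic -> (size s <= size t)%N.
Proof.
move=> fs sst; rewrite leqNgt; apply/negP => ts.
have tgt (i : 'I_(size s)) : lin_span t s`_i by apply/sst/mem_lin_span/mem_nth.
pose M := \matrix_(i < size s, j < size t) (projT1 (cid (tgt i)) j).
have : (\rank (kermx M) > 0)%N.
  rewrite mxrank_ker subn_gt0; apply: leq_ltn_trans ts; exact: rank_leq_col.
rewrite lt0n mxrank_eq0 => /rowV0Pn [w /sub_kermxP wM wN0].
case/negP: wN0; apply/eqP/rowP => i; rewrite mxE.
pose c (j : nat) := if insub j is Some k then w 0 k else 0.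
have ci (j : 'I_(size s)) : c j = w 0 j by rewrite /c valK.
rewrite -ci; apply: (fs c) => //; rewrite /lin_comb.
have sE (j : 'I_(size s)) : c j *: s`_j = \sum_(k < size t) (w 0 j * M j k) *: t`_k.
  rewrite ci {1}(projT2 (cid (tgt j))) scaler_sumr.
  by apply: eq_bigr => k _; rewrite mxE scalerA.
rewrite (eq_bigr _ (fun j _ => sE j)) exchange_big big1 //= => k _.
rewrite -scaler_suml.
have := congr1 (fun A : 'M_(_, _) => A 0 k) wM; rewrite !mxE => ->.
by rewrite scale0r.
Qed.

Lemma dimensionE U s : is_basis U s -> dimension U = size s.
Proof.
move=> [fs sU]; rewrite /dimension.
apply: xget_unique; first by exists s.
move=> d [t [ft tU] <-]; apply/eqP; rewrite eqn_leq.
by rewrite !lin_free_size // tU sU.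
Qed.

End Dimension.

HB.mixin Record Lmodule_hasBracket (K : fieldType) V of GRing.Lmodule K V := {
  bracket : V -> V -> V;
  bracket_linearl : forall y, linear (bracket^~ y);
  bracket_linearr : forall x, linear (bracket x)
}.

#[short(type="bracketAlgType")]
HB.structure Definition BracketAlgebra (K : fieldType) :=
  {V of Lmodule_hasBracket K V & GRing.Lmodule K V}.

HB.mixin Record BracketAlgebra_isLie (K : fieldType) V of BracketAlgebra K V := {
  bracketxx : forall x : V, bracket x x = 0;
  jacobi : forall x y z : V,
    bracket x (bracket y z) + bracket y (bracket z x) + bracket z (bracket x y) = 0
}.

#[short(type="lieAlgType")]
HB.structure Definition LieAlgebra (K : fieldType) :=
  {V of BracketAlgebra_isLie K V & BracketAlgebra K V}.

Section BracketTheory.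
Variables (K : fieldType) (V : bracketAlgType K).
Implicit Types x y z : V.

Lemma bracketDl x y z : bracket (x + y) z = bracket x z + bracket y z.
Proof. by have := bracket_linearl z 1 x y; rewrite !scale1r. Qed.
Lemma bracketDr x y z : bracket x (y + z) = bracket x y + bracket x z.
Proof. by have := bracket_linearr x 1 y z; rewrite !scale1r. Qed.
Lemma bracket0l z : bracket 0 z = 0.
Proof. by apply: (addrI (bracket 0 z)); rewrite -bracketDl !addr0. Qed.
Lemma bracket0r z : bracket z 0 = 0.
Proof. by apply: (addrI (bracket z 0)); rewrite -bracketDr !addr0. Qed.
Lemma bracketZl a x z : bracket (a *: x) z = a *: bracket x z.
Proof. by have := bracket_linearl z a x 0; rewrite bracket0l !addr0. Qed.
Lemma bracketZr a x z : bracket z (a *: x) = a *: bracket z x.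
Proof. by have := bracket_linearr z a x 0; rewrite bracket0r !addr0. Qed.
Lemma bracketNl x z : bracket (- x) z = - bracket x z.
Proof. by rewrite -scaleN1r bracketZl scaleN1r. Qed.
Lemma bracketNr x z : bracket z (- x) = - bracket z x.
Proof. by rewrite -scaleN1r bracketZr scaleN1r. Qed.

End BracketTheory.

Section IdealQuotient.
Variables (K : fieldType) (V : bracketAlgType K) (S : set V).

Inductive ideal_gen : V -> Prop :=
| Ideal_gen x of S x : ideal_gen x
| Ideal_0 : ideal_gen 0
| Ideal_D x y of ideal_gen x & ideal_gen y : ideal_gen (x + y)
| Ideal_Z a x of ideal_gen x : ideal_gen (a *: x)
| Ideal_l x y of ideal_gen x : ideal_gen (bracket y x)
| Ideal_r x y of ideal_gen x : ideal_gen (bracket x y).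

Definition ideal : V -> bool := fun x => `[< ideal_gen x >].

Lemma idealP x : reflect (ideal_gen x) (x \in ideal).
Proof. exact: asboolP. Qed.

Fact ideal_zmod_closed : zmod_closed ideal.
Proof.
split=> [|x y /idealP xI /idealP yI]; apply/idealP; first exact: Ideal_0.
by rewrite -scaleN1r; apply: Ideal_D => //; apply: Ideal_Z.
Qed.
HB.instance Definition _ := GRing.isZmodClosed.Build V ideal ideal_zmod_closed.

Definition ideal_zmod : zmodClosed V := GRing.ZmodClosed.clone V ideal _.
Definition lie_quot := Quotient.quot ideal_zmod.
HB.instance Definition _ := GRing.Zmodule.on lie_quot.

Definition lie_pi (x : V) : lie_quot := \pi_(Quotient.quot ideal_zmod) x.
Definition lie_repr (u : lie_quot) : V := repr u.

Lemma lie_reprK : cancel lie_repr lie_pi.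
Proof. exact: reprK. Qed.

Lemma lie_piP x y : lie_pi x = lie_pi y <-> ideal_gen (x - y).
Proof.
split=> [/eqP|/idealP xy]; first by rewrite -Quotient.idealrBE => /idealP.
by apply/eqP; rewrite -Quotient.idealrBE.
Qed.

Lemma lie_piD x y : lie_pi (x + y) = lie_pi x + lie_pi y.
Proof. exact: (raddfD (\pi_(Quotient.quot ideal_zmod))). Qed.

Lemma lie_pi_repr x : ideal_gen (lie_repr (lie_pi x) - x).
Proof. by apply/lie_piP; rewrite lie_reprK. Qed.

(* Locked so that unification never unfolds the operations to representatives. *)
Definition lie_quot_scale (a : K) (u : lie_quot) : lie_quot :=
  locked (lie_pi (a *: lie_repr u)).

Definition lie_quot_bracket (u v : lie_quot) : lie_quot :=
  locked (lie_pi (bracket (lie_repr u) (lie_repr v))).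

Lemma lie_quot_scaleE a x : lie_quot_scale a (lie_pi x) = lie_pi (a *: x).
Proof.
rewrite /lie_quot_scale -lock; apply/lie_piP.
by rewrite -scalerBr; apply/Ideal_Z/lie_pi_repr.
Qed.

Lemma lie_quot_bracketE x y :
  lie_quot_bracket (lie_pi x) (lie_pi y) = lie_pi (bracket x y).
Proof.
rewrite /lie_quot_bracket -lock; apply/lie_piP.
set x' := lie_repr _; set y' := lie_repr _.
have -> : bracket x' y' - bracket x y = bracket (x' - x) y' + bracket x (y' - y).
  by rewrite bracketDl bracketDr bracketNl bracketNr addrA subrK.
by apply: Ideal_D; [apply: Ideal_r|apply: Ideal_l]; apply: lie_pi_repr.
Qed.

Lemma lie_quot_ind (P : lie_quot -> Prop) : (forall x, P (lie_pi x)) -> forall u, P u.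
Proof. by move=> h u; rewrite -[u]lie_reprK. Qed.

Fact lie_quot_scaleA a b v :
  lie_quot_scale a (lie_quot_scale b v) = lie_quot_scale (a * b) v.
Proof. by elim/lie_quot_ind: v => x; rewrite !lie_quot_scaleE scalerA. Qed.

Fact lie_quot_scale1 : left_id 1 lie_quot_scale.
Proof. by elim/lie_quot_ind => x; rewrite lie_quot_scaleE scale1r. Qed.

Fact lie_quot_scaleDr : right_distributive lie_quot_scale +%R.
Proof.
move=> a; elim/lie_quot_ind => x; elim/lie_quot_ind => y.
by rewrite -lie_piD !lie_quot_scaleE scalerDr lie_piD.
Qed.

Fact lie_quot_scaleDl v : {morph lie_quot_scale^~ v : a b / a + b}.
Proof.
by move=> a b; elim/lie_quot_ind: v => x; rewrite !lie_quot_scaleE scalerDl lie_piD.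
Qed.

HB.instance Definition _ := GRing.Zmodule_isLmodule.Build K lie_quot
  lie_quot_scaleA lie_quot_scale1 lie_quot_scaleDr lie_quot_scaleDl.

Fact lie_pi_linear : linear lie_pi.
Proof. by move=> a x y; rewrite lie_piD -lie_quot_scaleE. Qed.
HB.instance Definition _ := GRing.isLinear.Build K V lie_quot _ lie_pi lie_pi_linear.

Lemma lie_pi_eq0 x : lie_pi x = 0 <-> ideal_gen x.
Proof. by rewrite -(linear0 lie_pi) lie_piP subr0. Qed.

Fact lie_quot_bracket_linearl v : linear (lie_quot_bracket^~ v).
Proof.
move=> a; elim/lie_quot_ind => x; elim/lie_quot_ind => y; elim/lie_quot_ind: v => z.
by rewrite -lie_pi_linear !lie_quot_bracketE bracketDl bracketZl lie_pi_linear.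
Qed.

Fact lie_quot_bracket_linearr v : linear (lie_quot_bracket v).
Proof.
move=> a; elim/lie_quot_ind => x; elim/lie_quot_ind => y; elim/lie_quot_ind: v => z.
by rewrite -lie_pi_linear !lie_quot_bracketE bracketDr bracketZr lie_pi_linear.
Qed.

HB.instance Definition _ := Lmodule_hasBracket.Build K lie_quot
  lie_quot_bracket_linearl lie_quot_bracket_linearr.

Lemma lie_pi_bracket : {morph lie_pi : x y / bracket x y}.
Proof. by move=> x y; rewrite -lie_quot_bracketE. Qed.

End IdealQuotient.

Section LieIdealQuotient.
Variables (K : fieldType) (V : lieAlgType K) (S : set V).

Fact lie_quot_bracketxx (u : lie_quot S) : bracket u u = 0.
Proof.
by elim/lie_quot_ind: u => x; rewrite -lie_pi_bracket bracketxx linear0.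
Qed.

Fact lie_quot_jacobi (u v w : lie_quot S) :
  bracket u (bracket v w) + bracket v (bracket w u) + bracket w (bracket u v) = 0.
Proof.
elim/lie_quot_ind: u => x; elim/lie_quot_ind: v => y; elim/lie_quot_ind: w => z.
by rewrite -!lie_pi_bracket -!linearD jacobi linear0.
Qed.

HB.instance Definition _ := BracketAlgebra_isLie.Build K (lie_quot S)
  lie_quot_bracketxx lie_quot_jacobi.

End LieIdealQuotient.

(* Bracketings of words: the monomials of the free nonassociative algebra, whose
   quotient by the Lie identities is the free Lie algebra. *)
Inductive magma (T : Type) := Leaf of T | Node of magma T & magma T.

Section MagmaChoice.
Variable T : choiceType.

Fixpoint magma_encode (t : magma T) : GenTree.tree T :=
  match t with
  | Leaf x => GenTree.Leaf x
  | Node l r => GenTree.Node 0 [:: magma_encode l; magma_encode r]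
  end.

Fixpoint magma_decode (t : GenTree.tree T) : option (magma T) :=
  match t with
  | GenTree.Leaf x => Some (Leaf x)
  | GenTree.Node _ [:: l; r] =>
      if (magma_decode l, magma_decode r) is (Some l', Some r')
      then Some (Node l' r') else None
  | _ => None
  end.

Lemma magma_encodeK : pcancel magma_encode magma_decode.
Proof. by elim=> //= l -> r ->. Qed.

HB.instance Definition _ := Choice.copy (magma T) (pcan_type magma_encodeK).
End MagmaChoice.

Section FreeMagmaAlgebra.
Variables (K : fieldType) (T : choiceType).

Definition free_nonassoc := {malg K[magma T]}.
HB.instance Definition _ := GRing.Lmodule.on free_nonassoc.

Definition magma_elt (t : magma T) : free_nonassoc := << t >>.

Definition magma_ext (W : lmodType K) (h : magma T -> W) (f : free_nonassoc) : W :=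
  \sum_(t <- msupp f) f@_t *: h t.

Lemma magma_extw (W : lmodType K) (h : magma T -> W) f (d : {fset magma T}) :
  (msupp f `<=` d)%fset -> magma_ext h f = \sum_(t <- d) f@_t *: h t.
Proof.
move=> fd; rewrite /magma_ext; apply: big_fset_incl => // t _.
by rewrite -mcoeff_eq0 => /eqP->; rewrite scale0r.
Qed.

Lemma magma_ext_linear (W : lmodType K) (h : magma T -> W) : linear (magma_ext h).
Proof.
move=> a f g.
pose d := (msupp f `|` msupp g `|` msupp (a *: f + g))%fset.
rewrite !(@magma_extw _ _ _ d) ?fsubsetUr //; last first.
- by rewrite /d -fsetUA fsubsetUl.
- by rewrite /d fsetUAC fsubsetUr.
rewrite scaler_sumr -big_split; apply: eq_bigr => t _.
by rewrite mcoeffD mcoeffZ scalerDl scalerA.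
Qed.

Lemma magma_ext_elt (W : lmodType K) (h : magma T -> W) t : magma_ext h (magma_elt t) = h t.
Proof.
rewrite (@magma_extw _ _ _ [fset t]%fset) ?msuppU_le //.
by rewrite big_seq_fset1 mcoeffUU scale1r.
Qed.

Definition magma_bracket (f g : free_nonassoc) : free_nonassoc :=
  magma_ext (fun s => magma_ext (fun t => magma_elt (Node s t)) g) f.

Fact magma_bracket_linearl g : linear (magma_bracket^~ g).
Proof. exact: magma_ext_linear. Qed.

Fact magma_bracket_linearr f : linear (magma_bracket f).
Proof.
move=> a g g'; rewrite /magma_bracket {1 3 5}/magma_ext.
rewrite scaler_sumr -big_split; apply: eq_bigr => s _ /=.
by rewrite magma_ext_linear scalerDr !scalerA mulrC.
Qed.

HB.instance Definition _ := Lmodule_hasBracket.Build K free_nonassoc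
  magma_bracket_linearl magma_bracket_linearr.

Lemma bracket_magma_elt s t :
  bracket (magma_elt s) (magma_elt t) = magma_elt (Node s t).
Proof. by rewrite /bracket /= /magma_bracket !magma_ext_elt. Qed.

Definition lie_axioms : set free_nonassoc := [set z |
  (exists x, z = bracket x x) \/
  (exists x y w, z =
    bracket x (bracket y w) + bracket y (bracket w x) + bracket w (bracket x y))]%classic.

Definition free_lie := lie_quot lie_axioms.
HB.instance Definition _ := BracketAlgebra.on free_lie.

Fact free_lie_bracketxx (u : free_lie) : bracket u u = 0.
Proof.
elim/lie_quot_ind: u => x; rewrite -lie_pi_bracket.
by apply/lie_pi_eq0/Ideal_gen; left; exists x.
Qed.

Fact free_lie_jacobi (u v w : free_lie) :
  bracket u (bracket v w) + bracket v (bracket w u) + bracket w (bracket u v) = 0.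
Proof.
elim/lie_quot_ind: u => x; elim/lie_quot_ind: v => y; elim/lie_quot_ind: w => z.
rewrite -!lie_pi_bracket -!lie_piD; apply/lie_pi_eq0.
by apply: Ideal_gen; right; exists x, y, z.
Qed.

HB.instance Definition _ := BracketAlgebra_isLie.Build K free_lie
  free_lie_bracketxx free_lie_jacobi.

Definition free_lie_gen (i : T) : free_lie := lie_pi lie_axioms (magma_elt (Leaf i)).

End FreeMagmaAlgebra.

Definition ht n (m : {ffun 'I_n -> nat}) : nat := \sum_i m i.

Fixpoint magma_wt n (t : magma 'I_n) : {ffun 'I_n -> nat} :=
  match t with
  | Leaf i => [ffun j => (i == j : nat)]
  | Node l r => [ffun j => (magma_wt l j + magma_wt r j)%N]
  end.

Section PartiallyCommutative.
Variables (K : fieldType) (n : nat) (e : rel 'I_n).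

(* The pairs i = j, also selected when e is irreflexive, only contribute
   [x, x] = 0. *)
Definition commutation_rels : set (free_lie K 'I_n) := [set z |
  exists i j, ~~ e i j /\ z = bracket (free_lie_gen K i) (free_lie_gen K j)]%classic.

Definition pc_lie := lie_quot commutation_rels.
HB.instance Definition _ := LieAlgebra.on pc_lie.

Definition pc_pi (f : free_nonassoc K 'I_n) : pc_lie :=
  lie_pi commutation_rels (lie_pi (@lie_axioms K 'I_n) f).

Fact pc_pi_linear : linear pc_pi.
Proof. by move=> a f g; rewrite /pc_pi lie_pi_linear lie_pi_linear. Qed.
HB.instance Definition _ := GRing.isLinear.Build K _ _ _ pc_pi pc_pi_linear.

(* Combinations of bracketings in which each i occurs exactly m i times; the
   grade space of degree m is the image of these in the quotient. *)
Definition homogeneous (m : {ffun 'I_n -> nat}) : set (free_nonassoc K 'I_n) :=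
  [set f | forall t, t \in msupp f -> magma_wt t = m]%classic.

Definition pc_grade (m : {ffun 'I_n -> nat}) : set pc_lie :=
  [set pc_pi f | f in homogeneous m]%classic.

Definition mult (m : {ffun 'I_n -> nat}) : nat := dimension (pc_grade m).

Fixpoint magma_enum d : seq (magma 'I_n) :=
  if d is d'.+1 then
    [seq Leaf i | i <- enum 'I_n] ++
    [seq Node l r | l <- magma_enum d', r <- magma_enum d']
  else [::].

Lemma ht_magma_gt0 (t : magma 'I_n) : (0 < ht (magma_wt t))%N.
Proof.
elim: t => [i|l IHl r _] /=; rewrite /ht.
  by rewrite (bigD1 i) //= ffunE eqxx.
by under eq_bigr do rewrite ffunE; rewrite big_split /= addn_gt0 [X in X || _]IHl.
Qed.

Lemma mem_magma_enum t d : (ht (magma_wt t) <= d)%N -> t \in magma_enum d.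
Proof.
elim: d t => [|d IHd] t; first by rewrite leqNgt ht_magma_gt0.
rewrite [magma_enum _]/= mem_cat; case: t => [i _|l r].
  by rewrite map_f // mem_enum.
have -> : ht (magma_wt (Node l r)) = (ht (magma_wt l) + ht (magma_wt r))%N.
  by rewrite /ht -big_split; apply: eq_bigr => i _; rewrite ffunE.
move=> lr; apply/orP; right; apply: allpairs_f; apply: IHd.
  by rewrite -ltnS; apply: leq_trans lr; rewrite -addn1 leq_add2l ht_magma_gt0.
by rewrite -ltnS; apply: leq_trans lr; rewrite -add1n leq_add2r ht_magma_gt0.
Qed.

Let pc_piD f g : pc_pi (f + g) = pc_pi f + pc_pi g.
Proof. exact: linearD. Qed.
Let pc_piZ a f : pc_pi (a *: f) = a *: pc_pi f.
Proof. exact: linearZ. Qed.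
Let pc_pi0 : pc_pi 0 = 0.
Proof. exact: linear0. Qed.
Let pc_pi_sum I (r : seq I) F : pc_pi (\sum_(i <- r) F i) = \sum_(i <- r) pc_pi (F i).
Proof. exact: linear_sum. Qed.

Lemma pc_gradeE m : pc_grade m =
  lin_span [seq pc_pi (magma_elt K t) | t <- magma_enum (ht m) & magma_wt t == m].
Proof.
apply/seteqP; split=> [_ [f fm <-]|].
  rewrite [f]monalgE pc_pi_sum big_seq.
  apply: (big_ind (lin_span _)) => [|x y|t tf]; [exact: lin_span0|exact: lin_spanD|].
  have -> : << f@_t *g t >> = f@_t *: magma_elt K t.
    by apply/malgP => t'; rewrite mcoeffZ !mcoeffU mulr_natr.
  rewrite pc_piZ; apply/lin_spanZ/mem_lin_span/map_f.
  rewrite mem_filter fm // eqxx; apply: mem_magma_enum; by rewrite fm.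
apply: lin_span_min => [|_ _ [f fm <-] [g gm <-]|a _ [f fm <-]|_ /mapP [t + ->]].
- by exists 0; [move=> t; rewrite msupp0 | exact: pc_pi0].
- exists (f + g); last exact: pc_piD.
  by move=> t /(fsubsetP (msuppD_le _ _)); rewrite in_fsetU => /orP [/fm|/gm].
- exists (a *: f); last exact: pc_piZ.
  by move=> t /(fsubsetP (msuppZ_le _ _)) /fm.
- rewrite mem_filter => /andP [/eqP tm _]; exists (magma_elt K t) => // t'.
  by move=> /(fsubsetP msuppU_le); rewrite in_fset1 => /eqP->.
Qed.

Lemma pc_grade_basis m : exists b, is_basis (pc_grade m) b.
Proof. by rewrite pc_gradeE; apply: is_basis_span. Qed.

(* A positive integer dividing every entry of a nonzero m is at most ht m. *)
Definition chrmult (m : {ffun 'I_n -> nat}) : rat :=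
  \sum_(1 <= l < (ht m).+1 | [forall i, (l %| m i)%N])
    (mult [ffun i => (m i %/ l)%N])%:R / l%:R.

End PartiallyCommutative.

Section BondLattice.
Variables (n : nat) (e : rel 'I_n).

Definition part_wt (P : {mset 'I_n}) : {ffun 'I_n -> nat} := [ffun i => P i].

Definition connected_part (P : {mset 'I_n}) : bool :=
  (P != mset0) &&
  [forall i, forall j, (i \in P) && (j \in P) ==>
    connect [rel x y | [&& x \in P, y \in P & e x y]] i j].

Definition bond_lattice (k : {ffun 'I_n -> nat}) : set {mset {mset 'I_n}} :=
  [set J : {mset {mset 'I_n}} |
    (forall P : {mset 'I_n}, P \in J -> connected_part P) /\
    (forall i, (\sum_(P <- J) P i)%N = k i)]%classic.

Definition chrmult_bond (K : fieldType) (J : {mset {mset 'I_n}}) : rat :=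
  \prod_(P <- finsupp J) (chrmult K e (part_wt P) ^+ J P / (J P)`!%:R).

Lemma bond_lattice_finite k : finite_set (bond_lattice k).
Proof.
set N := ht k.
pose code (J : {mset {mset 'I_n}}) : {ffun 'I_N -> {ffun 'I_n -> 'I_N.+1}} :=
  [ffun i : 'I_N => [ffun v => inord (nth mset0 (enum_mset J) i v)]].
have szJ J : bond_lattice k J -> (size J <= N)%N.
  move=> [Jc Jk]; rewrite /N /ht -(eq_bigr _ (fun i _ => Jk i)) exchange_big /=.
  rewrite -sum1_size big_seq [leqRHS]big_seq; apply: leq_sum => P /Jc /andP [P0 _].
  rewrite lt0n sum_nat_eq0; apply: contra P0 => /forallP /= P0.
  by apply/eqP/msetP => i; rewrite mset0E; apply/eqP/P0.
have leP J i v : bond_lattice k J -> (nth mset0 (enum_mset J) i v <= N)%N.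
  move=> [Jc Jk]; have [iJ|Ji] := ltnP i (size J); last by rewrite nth_default ?mset0E.
  apply: (@leq_trans (k v)); last by rewrite /N /ht (bigD1 v) //= leq_addr.
  by rewrite -Jk (big_rem _ (mem_nth mset0 iJ)) /= leq_addr.
rewrite -(eq_finite_set (@inj_card_eq _ _ (bond_lattice k) code _)).
  exact: finite_finset.
move=> J J' /set_mem JL /set_mem J'L cJ.
have nJ i : nth mset0 (enum_mset J) i = nth mset0 (enum_mset J') i.
  have [iN|Ni] := ltnP i N; last first.
    by rewrite !nth_default //; apply: leq_trans Ni; apply: szJ.
  apply/msetP => v; move/ffunP: cJ => /(_ (Ordinal iN)) /ffunP /(_ v).
  by rewrite !ffunE => /(congr1 (@nat_of_ord _)); rewrite !inordK ?ltnS ?leP.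
have N0 (A : {mset {mset 'I_n}}) i : bond_lattice k A -> (i < size A)%N ->
    nth mset0 (enum_mset A) i != mset0.
  by move=> [Ac _] iA; have /Ac /andP [] := mem_nth mset0 iA.
rewrite -[J]seq_mset_id -[J']seq_mset_id; congr seq_mset.
apply: (@eq_from_nth _ mset0) => [|i _]; last exact: nJ.
apply/eqP; rewrite eqn_leq; apply/andP; split; rewrite leqNgt; apply/negP => lt.
  by have := N0 _ _ JL lt; rewrite nJ nth_default ?eqxx.
by have := N0 _ _ J'L lt; rewrite -nJ nth_default ?eqxx.
Qed.

End BondLattice.

Section ChromaticPolynomial.
Variables (n : nat) (e : rel 'I_n) (k : {ffun 'I_n -> nat}).

Definition multicoloring (q : nat) : {set {ffun 'I_n -> {set 'I_q}}} :=
  [set c : {ffun 'I_n -> {set 'I_q}} |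
    [forall i, #|c i| == k i] &&
    [forall i, forall j, e i j ==> [disjoint c i & c j]]].

Definition colors_used q (c : {ffun 'I_n -> {set 'I_q}}) : {set 'I_q} :=
  [set x | [exists i, x \in c i]].

Definition onto_multicoloring q : {set {ffun 'I_n -> {set 'I_q}}} :=
  [set c in multicoloring q | colors_used c == [set: 'I_q]].

Lemma card_colors_used q (c : {ffun 'I_n -> {set 'I_q}}) :
  c \in multicoloring q -> (#|colors_used c| <= ht k)%N.
Proof.
rewrite inE => /andP [/forallP ck _].
have -> : colors_used c = \bigcup_(i in 'I_n) c i.
  apply/setP => x; rewrite inE; apply/existsP/bigcupP => [[i xi]|[i _ xi]]; by exists i.
rewrite /ht; apply: (big_ind2 (fun (A : {set 'I_q}) m => #|A| <= m)%N).
- by rewrite cards0.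
- by move=> A a B b Aa Bb; apply: leq_trans (leq_card_setU A B) (leq_add Aa Bb).
- by move=> i _; rewrite (eqP (ck i)).
Qed.

Lemma card_multicoloring_used q (U : {set 'I_q}) :
  #|[set c in multicoloring q | colors_used c == U]| = #|onto_multicoloring #|U| |.
Proof.
pose f (x : 'I_#|U|) : 'I_q := enum_val x.
have f_inj : injective f by apply: enum_val_inj.
pose phi (c : {ffun 'I_n -> {set 'I_#|U|}}) : {ffun 'I_n -> {set 'I_q}} :=
  [ffun i => f @: c i].
have phi_inj : injective phi.
  move=> c c' /ffunP E; apply/ffunP => i; move: (E i); rewrite !ffunE.
  exact: imset_inj.
have fU : f @: [set: 'I_#|U|] = U.
  apply/setP => x; apply/imsetP/idP => [[y _ ->]|xU]; first exact: enum_valP.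
  by exists (enum_rank_in xU x); rewrite // /f enum_rankK_in.
have phi_col c : (phi c \in multicoloring q) = (c \in multicoloring #|U|).
  rewrite !inE; congr (_ && _); apply: eq_forallb => i.
    by rewrite ffunE card_imset.
  apply: eq_forallb => j; rewrite !ffunE; congr (_ ==> _); exact: imset_disjoint.
have phi_used c : colors_used (phi c) = f @: colors_used c.
  apply/setP => x; rewrite inE; apply/existsP/imsetP.
    move=> [v]; rewrite ffunE => /imsetP [y yv ->]; exists y; rewrite // inE.
    by apply/existsP; exists v.
  by move=> [y + ->]; rewrite inE => /existsP [i yi]; exists i; rewrite ffunE imset_f.
rewrite -(card_imset _ phi_inj); apply: eq_card => c.
rewrite [in LHS]inE; apply/andP/imsetP.
  move=> [cm /eqP cU].
  pose c' : {ffun 'I_n -> {set 'I_#|U|}} := [ffun i => f @^-1: c i].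
  have cE : c = phi c'.
    apply/ffunP => i; rewrite !ffunE; apply/setP => x; apply/idP/imsetP.
      move=> xi; have xU : x \in U by rewrite -cU inE; apply/existsP; exists i.
      have /imsetP [y _ xE] : x \in f @: [set: 'I_#|U|] by rewrite fU.
      by exists y; rewrite // inE -xE.
    by move=> [y + ->]; rewrite inE.
  exists c' => //; rewrite inE -phi_col -cE cm /=; apply/eqP/(imset_inj f_inj).
  by rewrite fU -phi_used -cE.
move=> [c']; rewrite inE => /andP [c'm /eqP c'U] ->.
by rewrite phi_col c'm phi_used c'U fU.
Qed.

Lemma card_multicoloring q : #|multicoloring q| =
  (\sum_(j < (ht k).+1) 'C(q, j) * #|onto_multicoloring j|)%N.
Proof.
pose u (c : {ffun 'I_n -> {set 'I_q}}) : 'I_(ht k).+1 := inord #|colors_used c|.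
rewrite -sum1_card (partition_big u predT) //=; apply: eq_bigr => j _.
rewrite (partition_big (@colors_used q) [pred U : {set 'I_q} | #|U| == j]) /=; last first.
  move=> c /andP [cm /eqP <-]; by rewrite /u inordK // ltnS card_colors_used.
have -> : 'C(q, j) = #|[set U : {set 'I_q} | #|U| == j]| by rewrite card_draws card_ord.
rewrite -sum_nat_const.
apply: eq_big => [U|U /eqP Uj]; first by rewrite inE.
rewrite -Uj -card_multicoloring_used -sum1_card; apply: eq_bigl => c.
rewrite [in RHS]inE -andbA; congr (_ && _); rewrite andbC.
case: eqP => //= cU; apply/eqP/val_inj; by rewrite /u cU Uj inord_val.
Qed.

Lemma gchrom_poly_exists : exists p : {poly rat},
  forall q : nat, (0 < q)%N -> p.[q%:R] = #|multicoloring q|%:R.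
Proof.
exists (\sum_(j < (ht k).+1)
  (#|onto_multicoloring j|%:R / j`!%:R) *: \prod_(i < j) ('X - i%:R%:P)) => q _.
have ffactE j : (\prod_(i < j) ('X - i%:R%:P)).[q%:R] = (q ^_ j)%:R :> rat.
  elim: j => [|j IHj]; first by rewrite big_ord0 hornerC.
  rewrite big_ord_recr hornerM IHj ffactnSr natrM hornerXsubC.
  have [jq|qj] := leqP j q; first by rewrite natrB.
  by rewrite ffact_small ?mul0r.
rewrite card_multicoloring natr_sum horner_sum; apply: eq_bigr => j _.
rewrite hornerZ ffactE -bin_ffact !natrM mulrC -!mulrA; congr (_ * _).
by rewrite mulrC -mulrA mulVf ?mulr1 // pnatr_eq0 -lt0n fact_gt0.
Qed.

(* The choice is irrelevant, see gchrom_poly_unique. *)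
Definition gchrom_poly : {poly rat} := projT1 (cid gchrom_poly_exists).

Lemma gchrom_polyE q : (0 < q)%N -> gchrom_poly.[q%:R] = #|multicoloring q|%:R.
Proof. exact: (projT2 (cid gchrom_poly_exists)). Qed.

Lemma gchrom_poly_unique (p : {poly rat}) :
  (forall q : nat, (0 < q)%N -> p.[q%:R] = #|multicoloring q|%:R) -> p = gchrom_poly.
Proof.
move=> pE; apply/eqP; rewrite -subr_eq0; apply: contraT => rN0.
pose rs := [seq q%:R : rat | q <- iota 1 (size (p - gchrom_poly))].
suff /(max_poly_roots rN0) : all (root (p - gchrom_poly)) rs.
  rewrite size_map size_iota ltnn; apply.
  by rewrite map_inj_uniq ?iota_uniq // => x y /eqP; rewrite eqr_nat => /eqP.
apply/allP => _ /mapP [q + ->]; rewrite mem_iota => /andP [q0 _].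
by rewrite rootE hornerD hornerN pE // gchrom_polyE // subrr.
Qed.

Definition gchrom_poly_tilde : {poly rat} :=
  (-1) ^+ ht k *: (gchrom_poly \Po (- 'X)).

End ChromaticPolynomial.

(* Main.v *)
(* Write h for the generating series of the partially commutative monoid of words in I (two
   letters commute when they are not adjacent), graded by weight. Three facts combine.
   Cartier-Foata: the signed independence polynomial sum_S (-1)^|S| x^S over independent S is
   1 / h; its q-th power generates (-1)^(ht k) pi_k(q), since a multicoloring with q colors
   is a q-tuple of independent color classes.
   Poincare-Birkhoff-Witt: h = prod_m (1 - x^m)^(- mult m), so log h = sum_m chrmult(m) x^m.
   Injectivity of the Lie algebra into the monoid algebra comes from the Dynkin operator, for
   which L_m is an eigenspace of eigenvalue ht m; independence of the ordered monomials from
   pairing them with shuffle products of linear forms, on which the Lie algebra acts by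
   derivations; and spanning from straightening.
   Exponential formula: exp (q log h) is the sum over bonds in the statement.
   Logarithms and exponentials are avoided by working with the Euler derivation x^m |-> ht m x^m:
   both sides at -q solve the recursion ht m f(m) = - q sum_a ht a chrmult(a) f(m - a). *)

Require Import Defs.
From mathcomp Require Import all_boot all_order all_algebra.
From mathcomp Require Import finmap multiset.
From mathcomp Require Import boolp classical_sets fsbigop reals complex.
From mathcomp Require Import fintype finset zify ring.
From mathcomp.multinomials Require Import monalg.

Set Implicit Arguments.
Unset Strict Implicit.
Unset Printing Implicit Defensive.

Import Order.TTheory GRing.Theory Num.Theory.
Local Open Scope ring_scope.
Local Open Scope mset_scope.

(** * Weights *)

Section Weights.
Variable n : nat.
Implicit Types (a b m : {ffun 'I_n -> nat}) (w : seq 'I_n).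

(** No enveloping algebra is built. A bracketing acts on functions of words through [lact], which
    prefixes letters and turns brackets into commutators of operators; on functions invariant under
    the commutations the action factors through the quotient Lie algebra. Products in the enveloping
    algebra are thus seen only through the values at the empty word of composites of such operators.

    Everything is cut off at a bound N above ht m: basis elements have height below N and exponents
    are below N, so that only finite sums and ranks of matrices occur.

    Characteristic zero serves to divide by the eigenvalue of the Dynkin operator, and to know that
    a monomial pairs with its own shuffle product to a nonzero number, since that number is a
    positive integer.

    The denominators l in [chrmult] come from the logarithm of 1 / (1 - x^a); the Euler derivation
    cancels them because ht (l a) = l ht a. The recursion runs over all weights and the bonds only
    over connected ones; the difference is bridged by the vanishing of the Lie algebra in degrees of
    disconnected support. *)

Definition wle a b := [forall i, a i <= b i]%N.

Lemma wleP a b : reflect (forall i, a i <= b i)%N (wle a b).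
Proof. exact: forallP. Qed.

Lemma waddE a b i : (a + b) i = (a i + b i)%N.
Proof. by rewrite ffunE. Qed.

Lemma wmulE a l i : (a *+ l) i = (a i * l)%N.
Proof. by rewrite ffunMnE -mulr_natr natn. Qed.

Lemma w0E i : (0 : {ffun 'I_n -> nat}) i = 0%N.
Proof. by rewrite ffunE. Qed.

Definition wsub a b : {ffun 'I_n -> nat} := [ffun i => a i - b i]%N.

Lemma waddK a b : wsub (a + b) b = a.
Proof. by apply/ffunP => i; rewrite ffunE waddE addnK. Qed.

Lemma wsubK a b : wle b a -> wsub a b + b = a.
Proof. by move/wleP => ba; apply/ffunP => i; rewrite waddE ffunE subnK. Qed.

Lemma waddI a : injective (+%R a).
Proof. by move=> b c E; rewrite -(waddK b a) addrC E addrC waddK. Qed.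

Lemma wle_addl a b : wle a (b + a).
Proof. by apply/wleP => i; rewrite waddE leq_addl. Qed.

Lemma htD a b : ht (a + b) = (ht a + ht b)%N.
Proof. by rewrite /ht -big_split; apply: eq_bigr => i _; rewrite waddE. Qed.

Lemma ht0 : ht (0 : {ffun 'I_n -> nat}) = 0%N.
Proof. by rewrite /ht big1 // => i _; rewrite w0E. Qed.

Lemma htM a l : ht (a *+ l) = (ht a * l)%N.
Proof. by elim: l => [|l IH]; rewrite ?mulr0n ?ht0 ?muln0 // mulrS htD IH mulnS. Qed.

Lemma ht_sum (I : Type) (r : seq I) (P : pred I) (F : I -> {ffun 'I_n -> nat}) :
  ht (\sum_(i <- r | P i) F i) = (\sum_(i <- r | P i) ht (F i))%N.
Proof. exact: (big_morph _ htD ht0). Qed.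

Lemma ht_eq0 a : (ht a == 0%N) = (a == 0).
Proof.
rewrite /ht sum_nat_eq0; apply/forallP/eqP => [a0|-> i]; last by rewrite w0E.
by apply/ffunP => i; rewrite w0E; apply/eqP/(implyP (a0 i)).
Qed.

Lemma leq_ht a i : (a i <= ht a)%N.
Proof. by rewrite /ht (bigD1 i) //= leq_addr. Qed.

Lemma wle_ht a b : wle a b -> (ht a <= ht b)%N.
Proof. by move/wsubK <-; rewrite htD leq_addl. Qed.

Definition wwt w : {ffun 'I_n -> nat} := [ffun i => count_mem i w].

Lemma wwt_nil : wwt [::] = 0.
Proof. by apply/ffunP => i; rewrite !ffunE. Qed.

Lemma wwt_cat w w' : wwt (w ++ w') = wwt w + wwt w'.
Proof. by apply/ffunP => i; rewrite waddE !ffunE count_cat. Qed.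

Lemma wwt_cons x w : wwt (x :: w) = wwt [:: x] + wwt w.
Proof. by rewrite -wwt_cat. Qed.

Lemma ht_wwt w : ht (wwt w) = size w.
Proof.
elim: w => [|x w IH]; first by rewrite wwt_nil ht0.
rewrite wwt_cons htD IH /= -add1n; congr (_ + _)%N; rewrite /ht (bigD1 x) //= ffunE /= eqxx.
by rewrite big1 // => i ix; rewrite ffunE /= eq_sym (negbTE ix).
Qed.

Lemma wwt_eq0 w : (wwt w == 0) = (w == [::]).
Proof. by rewrite -ht_eq0 ht_wwt size_eq0. Qed.

Definition ind (S : {set 'I_n}) : {ffun 'I_n -> nat} := [ffun i => (i \in S : nat)].

Lemma wwt_enum (S : {set 'I_n}) : wwt (enum S) = ind S.
Proof. by apply/ffunP => i; rewrite !ffunE count_uniq_mem ?enum_uniq // mem_enum. Qed.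

Lemma ht_ind S : ht (ind S) = #|S|.
Proof. by rewrite -wwt_enum ht_wwt cardE. Qed.

End Weights.

Lemma mem_split (T : eqType) (x : T) s : x \in s -> exists a b, s = a ++ x :: b /\ x \notin a.
Proof.
elim: s => //= y s IH; rewrite inE; have [->|xy] := eqVneq x y.
  by move=> _; exists [::], s.
move=> /= /IH [a [b [-> xa]]]; exists (y :: a), b; split=> //.
by rewrite inE (negbTE xy).
Qed.

(** Toggling a fixed element of F pairs the subsets of F with opposite signs; only the empty F
    offers no such element. *)
Lemma sum_subset_sign (R : pzRingType) (T : finType) (F : {set T}) :
  \sum_(S : {set T} | S \subset F) (-1) ^+ #|S| = (F == set0)%:R :> R.
Proof.
have [->|[x xF]] := set_0Vmem F.
  rewrite eqxx (big_pred1 set0) ?cards0 // => S; exact: subset0.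
rewrite (_ : F == set0 = false); last by apply/negbTE/set0Pn; exists x.
rewrite (bigID (fun S : {set T} => x \in S)) /=.
rewrite (reindex_onto (fun S : {set T} => x |: S) (fun S : {set T} => S :\ x)) /=; last first.
  by move=> S /andP [_ xS]; rewrite finset.setD1K.
rewrite [X in X + _](_ : _ = - \sum_(S : {set T} | (S \subset F) && (x \notin S)) (-1) ^+ #|S|).
  by rewrite addrC subrr.
rewrite -sumrN; apply: eq_big => [S|S /andP [/andP [_ _] /eqP E]].
  rewrite finset.subUset finset.sub1set xF setU11 /= !andbT; congr (_ && _).
  apply/eqP/idP => [<-|xS]; first by rewrite !inE eqxx.
  by rewrite setU1K.
by rewrite cardsU1 -{1}E !inE eqxx exprS mulN1r.
Qed.

(** * Traces and Cartier-Foata inversion *)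

Section Traces.
Variables (n : nat) (e : rel 'I_n).
Implicit Types (u v w : seq 'I_n) (m : {ffun 'I_n -> nat}).

(* Equality in the partially commutative monoid, where i and j commute unless e i j: words
   are equal iff their projections on all pairs of adjacent letters and on all single
   letters (the case i = j) coincide. *)
Definition treq w w' :=
  [forall i, forall j, (e i j || (i == j)) ==>
    ([seq x <- w | pred2 i j x] == [seq x <- w' | pred2 i j x])].

Lemma treqP w w' : reflect
  (forall i j, e i j || (i == j) -> [seq x <- w | pred2 i j x] = [seq x <- w' | pred2 i j x])
  (treq w w').
Proof.
apply: (iffP forallP) => [H i j ij|H i].
  by move/forallP: (H i) => /(_ j) /implyP /(_ ij) /eqP.
by apply/forallP => j; apply/implyP => ij; apply/eqP/H.
Qed.

Lemma treq_refl w : treq w w. Proof. exact/treqP. Qed.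

Lemma treq_sym w w' : treq w w' = treq w' w.
Proof. by apply/treqP/treqP => H i j ij; rewrite H. Qed.

Lemma treq_trans u v w : treq u v -> treq v w -> treq u w.
Proof. by move=> /treqP H /treqP H'; apply/treqP => i j ij; rewrite H ?H'. Qed.

Lemma treq_catl u v v' : treq (u ++ v) (u ++ v') = treq v v'.
Proof.
apply/treqP/treqP => H i j ij; last by rewrite !filter_cat H.
by have /eqP := H i j ij; rewrite !filter_cat eqseq_cat // eqxx => /eqP.
Qed.

Lemma treq_cons x v v' : treq (x :: v) (x :: v') = treq v v'.
Proof. exact: (treq_catl [:: x]). Qed.

Lemma treq_wwt w w' : treq w w' -> wwt w = wwt w'.
Proof.
move=> /treqP H; apply/ffunP => i; rewrite !ffunE.
have cE u : count_mem i u = size [seq x <- u | pred2 i i x].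
  by rewrite size_filter; apply: eq_count => x /=; rewrite orbb.
by rewrite !cE H // eqxx orbT.
Qed.

Lemma treq_mem w w' : treq w w' -> w =i w'.
Proof.
move=> /treq_wwt /ffunP H x; move: (H x); rewrite !ffunE => c.
by rewrite -!has_pred1 !has_count c.
Qed.

Hypotheses (e_sym : symmetric e) (e_irr : irreflexive e).

Lemma treq_move x a b : x \notin a -> {in a, forall y, ~~ e x y} ->
  treq (a ++ x :: b) (x :: a ++ b).
Proof.
move=> xa ea; apply/treqP => i j ij; rewrite !filter_cat /= !filter_cat.
have [xij|] := boolP ((x == i) || (x == j)); last by [].
suff -> : [seq y <- a | pred2 i j y] = [::] by [].
apply/eqP; rewrite -(negbK (_ == _)) -has_filter; apply/hasPn => y ya /=.
have yx : y != x by apply: contraNneq xa => <-.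
have exy := ea y ya.
apply/norP; case/orP: xij ij => /eqP <- ij; split=> //.
- by apply/eqP => yj; case/orP: ij; [rewrite -yj (negbTE exy)|rewrite -yj eq_sym (negbTE yx)].
- by apply/eqP => yi; case/orP: ij; [rewrite -yi e_sym (negbTE exy)|rewrite -yi (negbTE yx)].
Qed.

Lemma treq_swap a i j b : ~~ e i j -> treq (a ++ i :: j :: b) (a ++ j :: i :: b).
Proof.
move=> ij; rewrite treq_catl; have [->|jNi] := eqVneq i j; first exact: treq_refl.
apply: (@treq_move j [:: i] b); first by rewrite inE eq_sym.
by move=> y; rewrite inE => /eqP ->; rewrite e_sym.
Qed.

(** A letter y adjacent to x and placed before the first x of v would start the projection of v to
    {x, y}, whereas that of x :: w starts with x. So the first x of v can be moved to the front and
    cancelled. *)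
Lemma treq_head x w v : treq (x :: w) v -> exists a b,
  [/\ v = a ++ x :: b, x \notin a, {in a, forall y, ~~ e x y} & treq w (a ++ b)].
Proof.
move=> H; have : x \in v by rewrite -(treq_mem H) mem_head.
move=> /mem_split [a [b [vE xa]]]; exists a, b.
have ea : {in a, forall y, ~~ e x y}.
  move=> y ya; apply/negP => exy.
  have /treqP /(_ x y) := H; rewrite exy vE filter_cat /= eqxx => /(_ isT).
  have := mem_filter (pred2 x y) y a; rewrite /= eqxx orbT ya /=.
  case E : [seq _ <- a | _] => [//|z s] _ /= [xz _].
  by have := mem_head z s; rewrite -E -xz mem_filter (negbTE xa) andbF.
split=> //; rewrite -(treq_cons x); apply: treq_trans H _; rewrite vE.
exact: treq_move.
Qed.

(** These are the functions on the partially commutative monoid, written on words. *)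
Definition swap_inv (T : Type) (f : seq 'I_n -> T) :=
  forall a i j b, ~~ e i j -> f (a ++ i :: j :: b) = f (a ++ j :: i :: b).

Lemma swap_inv_cons T (f : seq 'I_n -> T) x :
  swap_inv f -> swap_inv (fun w => f (x :: w)).
Proof. by move=> fi a i j b ij; apply: (fi (x :: a)). Qed.

(** This identifies the congruence defined by projections with the one generated by commutations. In
    the induction, the head letter of w is brought to the front of w' by swaps and then absorbed
    into f. *)
Lemma swap_inv_treq T (f : seq 'I_n -> T) w w' : swap_inv f -> treq w w' -> f w = f w'.
Proof.
elim: w w' f => [|x w IH] w' f fi ww'.
  by have /eqP := treq_wwt ww'; rewrite wwt_nil eq_sym wwt_eq0 => /eqP ->.
have [a [b [-> _ ea tw]]] := treq_head ww'.
rewrite (IH _ _ (swap_inv_cons x fi) tw).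
suff H c : f (c ++ x :: a ++ b) = f (c ++ a ++ x :: b) by apply: (H [::]).
elim: a {tw ww'} ea c => //= y a IHa ea c.
rewrite fi; last by apply: ea; rewrite mem_head.
rewrite -cat1s catA IHa -?catA // => z za.
by apply: ea; rewrite inE za orbT.
Qed.

(** One word per class, the same for all words of the class, so that traces can be counted as the
    fixed points of [canon]. *)
Definition canon w : seq 'I_n := choose (treq w) w.

Lemma treq_canon w : treq w (canon w).
Proof. by apply: chooseP; apply: treq_refl. Qed.

Lemma canonP w w' : reflect (canon w = canon w') (treq w w').
Proof.
apply: (iffP idP) => [ww'|E]; last first.
  by apply: (treq_trans (treq_canon w)); rewrite E treq_sym treq_canon.
rewrite /canon (@eq_choose _ (treq w) (treq w')); last first.
  by move=> v; apply/idP/idP; apply: treq_trans => //; rewrite treq_sym.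
by apply: choose_id; rewrite // ?treq_refl // treq_sym.
Qed.

Lemma canonK w : canon (canon w) = canon w.
Proof. by apply/canonP; rewrite treq_sym treq_canon. Qed.

Lemma wwt_canon w : wwt (canon w) = wwt w.
Proof. by apply/esym/treq_wwt/treq_canon. Qed.

Definition traces m : seq (seq 'I_n) :=
  [seq w <- [seq val t | t <- enum {: (ht m).-tuple 'I_n}] | (wwt w == m) && (canon w == w)].

Lemma mem_traces m w : (w \in traces m) = (wwt w == m) && (canon w == w).
Proof.
rewrite mem_filter; apply: andb_idr => /andP [/eqP wm _]; apply/mapP.
have sw : size w == ht m by rewrite -wm ht_wwt.
by exists (Tuple sw); rewrite // mem_enum.
Qed.

Lemma traces_uniq m : uniq (traces m).
Proof. by apply: filter_uniq; rewrite (map_inj_uniq val_inj) enum_uniq. Qed.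

Lemma canon_traces m w : wwt w = m -> canon w \in traces m.
Proof. by move=> wm; rewrite mem_traces wwt_canon wm canonK !eqxx. Qed.

(** The letters that can be commuted to the front of u, in a form decidable from projections. *)
Definition first u : {set 'I_n} :=
  [set x | (x \in u) && [forall y, e x y ==> (ohead [seq z <- u | pred2 x y z] == Some x)]].

Lemma firstP x u : reflect (exists v, treq u (x :: v)) (x \in first u).
Proof.
rewrite inE; apply: (iffP andP) => [[xu /forallP H]|[v uv]].
  have [a [b [uE xa]]] := mem_split xu.
  exists (a ++ b); rewrite uE; apply: treq_move => // y ya; apply/negP => exy.
  move: (H y); rewrite exy uE filter_cat /=.
  have := mem_filter (pred2 x y) y a; rewrite /= eqxx orbT ya /=.
  case E : [seq _ <- a | _] => [//|z s] _ /= /eqP [zx].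
  by have := mem_head z s; rewrite -E zx mem_filter (negbTE xa) andbF.
split; first by rewrite (treq_mem uv) mem_head.
apply/forallP => y; apply/implyP => exy.
by move/treqP: uv => ->; rewrite ?exy //= eqxx.
Qed.

Lemma first_indep u : {in first u &, forall x y, ~~ e x y}.
Proof.
move=> x y; rewrite !inE => /andP [_ /forallP/(_ y) Hx] /andP [_ /forallP/(_ x) Hy].
apply/negP => exy; move: Hx Hy; rewrite exy e_sym exy /= => /eqP Hx.
rewrite (eq_filter (a2 := pred2 x y)); last by move=> z /=; rewrite orbC.
by rewrite Hx => /eqP [xy]; move: exy; rewrite xy e_irr.
Qed.

Lemma first_eq0 u : (first u == set0) = (u == [::]).
Proof.
case: u => [|x u]; first by apply/eqP/setP => x; rewrite !inE.
by apply/set0Pn; exists x; apply/firstP; exists u; apply: treq_refl.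
Qed.

(** Two letters of [first u] are not adjacent, so taking one off the front leaves intact the
    projections that test the other. The letters of S can therefore be extracted one by one. *)
Lemma first_subsetP (S : {set 'I_n}) u :
  reflect ({in S &, forall x y, ~~ e x y} /\ exists v, treq u (enum S ++ v)) (S \subset first u).
Proof.
apply: (iffP idP) => [Su|[Si [v uv]]].
  split=> [x y xS yS|]; first by apply: (@first_indep u); apply: (subsetP Su).
  have : {subset enum S <= first u} by move=> x; rewrite mem_enum; apply/subsetP.
  elim: (enum S) (enum_uniq S) u {Su} => [|x s IH] /= us u su.
    by exists u; apply: treq_refl.
  case/andP: us => xs us; have xu : x \in first u by apply: su; rewrite mem_head.
  have /firstP [v uv] := xu.
  have [|v' vv'] := IH us v; last first.
    by exists v'; apply: (treq_trans uv); rewrite treq_cons.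
  move=> y ys; have yu : y \in first u by apply: su; rewrite inE ys orbT.
  have yx : y != x by apply: contraNneq xs => <-.
  have /firstP [v' uv'] := yu.
  have := uv; rewrite treq_sym => /treq_trans /(_ uv') H.
  rewrite inE; apply/andP; split.
    by have := treq_mem H y; rewrite !inE eqxx (negbTE yx).
  apply/forallP => z; apply/implyP => eyz.
  move/treqP: H => /(_ y z); rewrite eyz /= eqxx eq_sym (negbTE yx) /=.
  have /negbTE -> : x != z; last by move=> /(_ isT) ->.
  by apply: contraTneq eyz => <-; apply: (@first_indep u).
apply/subsetP => x xS; apply/firstP.
have : x \in enum S by rewrite mem_enum.
move=> /mem_split [a [b [E xa]]]; exists (a ++ b ++ v).
apply: (treq_trans uv); rewrite E -catA /=; apply: treq_move => // y ya.
by apply: Si => //; rewrite -mem_enum E mem_cat ya.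
Qed.

Definition indep (S : {set 'I_n}) := [forall x in S, forall y in S, ~~ e x y].

Lemma indepP (S : {set 'I_n}) : reflect {in S &, forall x y, ~~ e x y} (indep S).
Proof.
apply: (iffP forallP) => [H x y xS yS|H x].
  by move/implyP: (H x) => /(_ xS) /forallP /(_ y) /implyP /(_ yS).
by apply/implyP => xS; apply/forallP => y; apply/implyP => yS; apply: H.
Qed.

(** Prefixing S is a bijection between the two families of traces; its injectivity is left
    cancellation. *)
Lemma size_traces_sub (S : {set 'I_n}) m : indep S -> wle (ind S) m ->
  size (traces (wsub m (ind S))) = count (fun u => S \subset first u) (traces m).
Proof.
move=> /indepP Si Sm; rewrite -size_filter.
pose f v := canon (enum S ++ v).
rewrite -(size_map f); apply/perm_size/uniq_perm.
- rewrite map_inj_in_uniq ?traces_uniq // => v v'.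
  rewrite !mem_traces => /andP [_ /eqP vc] /andP [_ /eqP v'c] /canonP.
  by rewrite treq_catl => /canonP; rewrite vc v'c.
- by rewrite filter_uniq ?traces_uniq.
move=> u; rewrite mem_filter; apply/mapP/andP => [[v vt ->]|[/first_subsetP [_ [v uv]] ut]].
  split; last first.
    apply: canon_traces; rewrite wwt_cat wwt_enum.
    by move: vt; rewrite mem_traces => /andP [/eqP -> _]; rewrite addrC wsubK.
  by apply/first_subsetP; split=> //; exists v; rewrite treq_sym treq_canon.
move: ut; rewrite mem_traces => /andP [/eqP um /eqP uc].
exists (canon v).
  by apply: canon_traces; rewrite -um (treq_wwt uv) wwt_cat wwt_enum addrC waddK.
rewrite /f -uc; apply/canonP; apply: (treq_trans uv).
by rewrite treq_catl treq_canon.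
Qed.

(* Cartier-Foata inversion: the pairs (S, v) with S ++ v equivalent to u are given
   by the subsets S of first u. *)
Lemma cartier_foata m :
  \sum_(S : {set 'I_n} | indep S && wle (ind S) m)
    (-1) ^+ #|S| * (size (traces (wsub m (ind S))))%:R = (m == 0)%:R :> rat.
Proof.
transitivity (\sum_(u <- traces m) (first u == set0)%:R : rat); last first.
  under eq_bigr do rewrite first_eq0 -wwt_eq0.
  rewrite big_seq; under eq_bigr => u do rewrite mem_traces => /andP [/eqP -> _].
  rewrite -big_seq; have [-> {m}|m0] := eqVneq m 0; last by rewrite big1.
  rewrite (perm_big [:: [::]]) ?big_seq1 //; apply: uniq_perm; rewrite ?traces_uniq //.
  move=> w; rewrite mem_traces wwt_eq0 inE; apply: andb_idr => /eqP ->.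
  by rewrite -wwt_eq0 wwt_canon wwt_nil.
transitivity (\sum_(u <- traces m) \sum_(S : {set 'I_n} | indep S && wle (ind S) m)
    (-1) ^+ #|S| * (S \subset first u)%:R : rat).
  rewrite exchange_big; apply: eq_bigr => S /andP [Si Sm].
  rewrite size_traces_sub // -sum1_count natr_sum mulr_sumr big_mkcond.
  by apply: eq_bigr => u _; case: ifP; rewrite ?mulr0.
apply: eq_big_seq => u; rewrite mem_traces => /andP [/eqP um _].
(* A subset of [first u] is automatically independent and of weight at most m, so the inner sum runs
   over all subsets of [first u]. *)
rewrite -sum_subset_sign [LHS]big_mkcond [RHS]big_mkcond; apply: eq_bigr => S _.
case: (boolP (S \subset _)) => [/first_subsetP [Si [v uv]]|_]; last by rewrite mulr0 if_same.
rewrite (introT (indepP S) Si) mulr1 /= ifT //; apply/wleP => i.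
by rewrite -um (treq_wwt uv) wwt_cat wwt_enum waddE leq_addr.
Qed.
End Traces.

(** * The Lie algebra acting on functions of words *)

Section LetterAction.
Variable n : nat.
Implicit Types (t : magma 'I_n) (v w : seq 'I_n).

(* The action of the Lie algebra on functions of traces, dual to multiplication. *)
Fixpoint lact (V : zmodType) t (f : seq 'I_n -> V) w : V :=
  match t with
  | Leaf i => f (i :: w)
  | Node l r => lact l (lact r f) w - lact r (lact l f) w
  end.

(** Every bracketing prefixes at least one letter, so the value at the empty word is never
    consulted. *)
Lemma lact_ext (V : zmodType) t (f g : seq 'I_n -> V) w :
  (forall v, v != [::] -> f v = g v) -> lact t f w = lact t g w.
Proof.
elim: t f g w => [i|l IHl r IHr] f g w fg /=; first exact: fg.
by congr (_ - _); [apply: IHl => v _; apply: IHr|apply: IHr => v _; apply: IHl].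
Qed.

Lemma eq_lact (V : zmodType) t (f g : seq 'I_n -> V) : f =1 g -> lact t f =1 lact t g.
Proof. by move=> fg w; apply: lact_ext => v _. Qed.

Lemma magma_wt_leaf (i : 'I_n) : magma_wt (Leaf i) = wwt [:: i].
Proof. by apply/ffunP => j; rewrite !ffunE /= addn0. Qed.

Lemma magma_wt_node (l r : magma 'I_n) : magma_wt (Node l r) = magma_wt l + magma_wt r.
Proof. by apply/ffunP => j; rewrite !ffunE. Qed.

Lemma sum_wt_leaf (w : seq 'I_n) : \sum_(t <- map (@Leaf _) w) magma_wt t = wwt w.
Proof.
elim: w => [|i w IH]; first by rewrite big_nil wwt_nil.
by rewrite big_cons IH magma_wt_leaf -wwt_cons.
Qed.

Lemma lact_local (V : zmodType) t (f g : seq 'I_n -> V) w :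
  (forall v, wwt v = magma_wt t + wwt w -> f v = g v) -> lact t f w = lact t g w.
Proof.
elim: t f g w => [i|l IHl r IHr] f g w; rewrite ?magma_wt_leaf ?magma_wt_node => fg.
  by apply: fg; rewrite wwt_cons.
rewrite /=; congr (_ - _); [apply: IHl => v E; apply: IHr => u F|apply: IHr => v E;
  apply: IHl => u F];
  by apply: fg; rewrite F E !addrA // [magma_wt r + _]addrC.
Qed.

Lemma lact_comp (V U : zmodType) (h : V -> U) t f w :
  {morph h : x y / x - y} -> lact t (fun v => h (f v)) w = h (lact t f w).
Proof.
move=> hB; elim: t f w => [//|l IHl r IHr] f w /=; rewrite hB -IHl -IHr.
by congr (_ - _); apply: eq_lact.
Qed.

Lemma lactB (V : zmodType) t (f g : seq 'I_n -> V) w :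
  lact t (fun v => f v - g v) w = lact t f w - lact t g w.
Proof.
elim: t f g w => [//|l IHl r IHr] f g w /=.
rewrite (eq_lact l (IHr _ _)) (eq_lact r (IHl _ _)) IHl IHr.
by rewrite opprD addrACA -opprD.
Qed.

Lemma lact_sumr (V : zmodType) I (s : seq I) (P : pred I) (F : I -> seq 'I_n -> V) t w :
  lact t (fun v => \sum_(i <- s | P i) F i v) w = \sum_(i <- s | P i) lact t (F i) w.
Proof.
elim: t F w => [//|l IHl r IHr] F w /=.
by rewrite (eq_lact l (IHr _)) (eq_lact r (IHl _)) IHl IHr -sumrB.
Qed.

Lemma lact_sum (K : nzRingType) (V : lmodType K) I (s : seq I) (P : pred I) (c : I -> K)
    (F : I -> seq 'I_n -> V) t w :
  lact t (fun v => \sum_(i <- s | P i) c i *: F i v) w = \sum_(i <- s | P i) c i *: lact t (F i) w.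
Proof.
rewrite lact_sumr; apply: eq_bigr => i _.
by apply: (lact_comp (h := fun u => c i *: u)) => x y; rewrite scalerBr.
Qed.

Lemma lact0 (V : zmodType) t w : lact t (fun=> 0 : V) w = 0.
Proof.
rewrite -[RHS](subrr (lact t (fun=> 0 : V) w)) -lactB.
by apply: eq_lact => v; rewrite subrr.
Qed.

Lemma lact_swap_inv (e : rel 'I_n) (V : zmodType) t (f : seq 'I_n -> V) :
  swap_inv e f -> swap_inv e (lact t f).
Proof.
elim: t f => [i|l IHl r IHr] f fi; first exact: swap_inv_cons.
by move=> a i j b ij /=; congr (_ - _); [apply/IHl/ij/IHr|apply/IHr/ij/IHl].
Qed.

Section Extension.
Variables (K : fieldType) (V : lmodType K).
Implicit Types (x y z : free_nonassoc K 'I_n) (f : seq 'I_n -> V).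

Definition lext x f w : V := magma_ext (fun t => lact t f w) x.

Lemma lext_linear f w : linear (fun x => lext x f w).
Proof. exact: magma_ext_linear. Qed.

Lemma lextD x y f w : lext (x + y) f w = lext x f w + lext y f w.
Proof. by have := lext_linear f w 1 x y; rewrite !scale1r. Qed.
Lemma lext0 f w : lext 0 f w = 0.
Proof. by apply: (addrI (lext 0 f w)); rewrite -lextD !addr0. Qed.
Lemma lextZ a x f w : lext (a *: x) f w = a *: lext x f w.
Proof. by have := lext_linear f w a x 0; rewrite lext0 !addr0. Qed.
Lemma lextB_elt x y f w : lext (x - y) f w = lext x f w - lext y f w.
Proof. by rewrite lextD -[- y]scaleN1r lextZ scaleN1r. Qed.
Lemma lext_sum I (s : seq I) (P : pred I) (F : I -> free_nonassoc K 'I_n) f w :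
  lext (\sum_(i <- s | P i) F i) f w = \sum_(i <- s | P i) lext (F i) f w.
Proof. exact: (big_morph (fun x => lext x f w) (fun x y => lextD x y f w) (lext0 f w)). Qed.

Lemma lext_elt t f w : lext (magma_elt K t) f w = lact t f w.
Proof. exact: magma_ext_elt. Qed.

Lemma eq_lext x f g : f =1 g -> lext x f =1 lext x g.
Proof. by move=> fg w; apply: eq_bigr => t _; rewrite (eq_lact t fg). Qed.

Lemma lextB x f g w : lext x (fun v => f v - g v) w = lext x f w - lext x g w.
Proof. by rewrite -sumrB; apply: eq_bigr => t _; rewrite lactB scalerBr. Qed.

Lemma lext_zero x w : lext x (fun=> 0) w = 0.
Proof. by rewrite /lext /magma_ext big1 // => t _; rewrite lact0 scaler0. Qed.

Lemma lext_bracket x y f w :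
  lext (bracket x y) f w = lext x (lext y f) w - lext y (lext x f) w.
Proof.
rewrite [bracket x y]/(magma_bracket x y) /magma_bracket {1}/magma_ext lext_sum.
have lE a b : lext a (lext b f) w =
    \sum_(s <- msupp a) \sum_(t <- msupp b) (a@_s * b@_t) *: lact s (lact t f) w.
  apply: eq_bigr => s _; rewrite [lact s _ _]lact_sum scaler_sumr.
  by apply: eq_bigr => t _; rewrite scalerA.
rewrite !lE [X in _ - X]exchange_big -sumrB; apply: eq_bigr => s _.
rewrite lextZ /magma_ext lext_sum scaler_sumr -sumrB; apply: eq_bigr => t _.
by rewrite lextZ lext_elt /= !scalerBr !scalerA [y@_t * _]mulrC.
Qed.

Lemma lext_bracketr x y z f w : lext x (lext (bracket y z) f) w =
  lext x (lext y (lext z f)) w - lext x (lext z (lext y f)) w.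
Proof. by rewrite -lextB; apply: eq_lext => v; apply: lext_bracket. Qed.

(** Commutators of operators satisfy the Lie identities; hence the action descends to the free Lie
    algebra. *)
Lemma lext_lie_axioms x f w : ideal_gen (@lie_axioms K 'I_n) x -> lext x f w = 0.
Proof.
move=> gx; elim: {x} gx f w.
- move=> x; rewrite /lie_axioms /=; case=> [[y ->]|[y [z [u ->]]]] f w.
    by rewrite lext_bracket subrr.
  pose A a b c := lext a (lext b (lext c f)) w.
  have J a b c :
      lext (bracket a (bracket b c)) f w = (A a b c - A a c b) - (A b c a - A c b a).
    by rewrite [LHS]lext_bracket [X in X - _]lext_bracketr [X in _ - X]lext_bracket.
  rewrite 2!lextD.
  transitivity (((A y z u - A y u z) - (A z u y - A u z y)) +
    ((A z u y - A z y u) - (A u y z - A y u z)) + ((A u y z - A u z y) - (A y z u - A z y u))).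
    by congr (_ + _ + _); apply: J.
  move: (A y z u) (A y u z) (A z u y) (A z y u) (A u y z) (A u z y) => a1 a2 a3 a4 a5 a6.
  have H (b1 b2 b3 b4 : V) : (b1 - b2) - (b3 - b4) = (b1 + b4) - (b2 + b3).
    by rewrite opprB addrACA -opprD.
  rewrite !{}H.
  have H (p1 p2 p3 q1 q2 q3 : V) : p1 + p2 + p3 = q1 + q2 + q3 ->
      (p1 - q1) + (p2 - q2) + (p3 - q3) = 0.
    by move=> E; rewrite [p1 - q1 + _]addrACA -opprD addrACA -opprD E subrr.
  apply: H.
  by rewrite [a1 + a6]addrC [a3 + a2]addrC [a5 + a4]addrC -addrA addrC.
- exact: lext0.
- by move=> x y _ IHx _ IHy f w; rewrite lextD IHx IHy addr0.
- by move=> a x _ IHx f w; rewrite lextZ IHx scaler0.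
- by move=> x y _ IHx f w; rewrite lext_bracket IHx (eq_lext _ (IHx f)) lext_zero subr0.
- by move=> x y _ IHx f w; rewrite lext_bracket IHx (eq_lext _ (IHx f)) lext_zero subr0.
Qed.

Lemma lext_lie_pi x y f w :
  lie_pi (@lie_axioms K 'I_n) x = lie_pi (@lie_axioms K 'I_n) y -> lext x f w = lext y f w.
Proof. by move/lie_piP/(lext_lie_axioms f w); rewrite lextB_elt => /subr0_eq. Qed.

Lemma lext_swap_inv (e : rel 'I_n) x f : swap_inv e f -> swap_inv e (lext x f).
Proof.
by move=> fi a i j b ij; apply: eq_bigr => t _; congr (_ *: _); apply: (lact_swap_inv t fi).
Qed.

(** The action descends further to the quotient by commutations, but only on invariant functions, a
    class that the action preserves. Quantifying over all lifts x of u lets the induction over the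
    ideal pick a convenient lift. *)
Lemma lext_commutation (e : rel 'I_n) (u : free_lie K 'I_n) :
  ideal_gen (@commutation_rels K n e) u -> forall x, lie_pi (@lie_axioms K 'I_n) x = u ->
  forall f w, swap_inv e f -> lext x f w = 0.
Proof.
elim=> {u}.
- move=> u [i [j [ij ->]]] x xE f w fi.
  rewrite (@lext_lie_pi x (bracket (magma_elt K (Leaf i)) (magma_elt K (Leaf j)))).
    by rewrite bracket_magma_elt lext_elt /= (fi [::] i j w ij) subrr.
  by rewrite xE -lie_pi_bracket.
- by move=> x /lie_pi_eq0 x0 f w _; apply: lext_lie_axioms.
- move=> u v _ IHu _ IHv x xE f w fi.
  rewrite (@lext_lie_pi x (lie_repr u + lie_repr v)); last by rewrite lie_piD !lie_reprK.
  by rewrite lextD IHu ?IHv ?addr0 ?lie_reprK.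
- move=> a u _ IHu x xE f w fi.
  rewrite (@lext_lie_pi x (a *: lie_repr u)); last by rewrite linearZ /= lie_reprK.
  by rewrite lextZ IHu ?scaler0 ?lie_reprK.
- move=> u v _ IHu x xE f w fi.
  rewrite (@lext_lie_pi x (bracket (lie_repr v) (lie_repr u))); last first.
    by rewrite lie_pi_bracket !lie_reprK.
  rewrite lext_bracket [X in _ - X]IHu ?lie_reprK //; last exact: lext_swap_inv.
  by rewrite subr0 -[RHS](lext_zero (lie_repr v) w); apply: eq_lext => w'; apply: IHu;
    rewrite ?lie_reprK.
- move=> u v _ IHu x xE f w fi.
  rewrite (@lext_lie_pi x (bracket (lie_repr u) (lie_repr v))); last first.
    by rewrite lie_pi_bracket !lie_reprK.
  rewrite lext_bracket [X in X - _]IHu ?lie_reprK //; last exact: lext_swap_inv.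
  apply/eqP; rewrite sub0r oppr_eq0 -(lext_zero (lie_repr v) w); apply/eqP.
  by apply: eq_lext => w'; apply: IHu; rewrite ?lie_reprK.
Qed.

Lemma lext_pc_pi (e : rel 'I_n) x f w : swap_inv e f -> pc_pi e x = 0 -> lext x f w = 0.
Proof. by move=> fi /lie_pi_eq0 /lext_commutation; apply. Qed.

End Extension.
End LetterAction.

(** * The Dynkin operator *)

Section LieEvaluation.
Variables (K : fieldType) (L : lieAlgType K) (n : nat) (e : rel 'I_n) (g : 'I_n -> L).
Implicit Types (u v : L) (t : magma 'I_n) (w : seq 'I_n).

Lemma bracketC u v : bracket u v = - bracket v u.
Proof.
have := bracketxx (u + v); rewrite bracketDl !bracketDr !bracketxx add0r addr0.
by move/eqP; rewrite addr_eq0 => /eqP.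
Qed.

Lemma bracket_derivation u v (w : L) :
  bracket u (bracket v w) = bracket (bracket u v) w + bracket v (bracket u w).
Proof.
have := jacobi u v w; rewrite [bracket w (bracket _ _)]bracketC [bracket w u]bracketC bracketNr.
by move/eqP; rewrite -addrA addr_eq0 opprD !opprK addrC => /eqP.
Qed.

Fixpoint lie_eval t : L :=
  match t with Leaf i => g i | Node l r => bracket (lie_eval l) (lie_eval r) end.

Lemma bracket_eval0 u t :
  (forall i, (0 < magma_wt t i)%N -> bracket u (g i) = 0) -> bracket u (lie_eval t) = 0.
Proof.
elim: t => [i|l IHl r IHr] H /=; first by apply: H; rewrite ffunE eqxx.
rewrite bracket_derivation IHl ?IHr ?bracket0l ?bracket0r ?addr0 //.
- by move=> i ri; apply: H; rewrite ffunE addn_gt0 ri orbT.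
- by move=> i li; apply: H; rewrite ffunE addn_gt0 li.
Qed.

(* Left-normed bracketing; the word is read backwards so that prefixing a letter is a
   right multiplication. *)
Fixpoint dynkin w : L :=
  match w with
  | [::] => 0
  | i :: w' => if w' is [::] then g i else bracket (dynkin w') (g i)
  end.

Lemma dynkin_cons i w : w != [::] -> dynkin (i :: w) = bracket (dynkin w) (g i).
Proof. by case: w. Qed.

Lemma dynkin_eval w : w != [::] -> exists2 t, magma_wt t = wwt w & dynkin w = lie_eval t.
Proof.
elim: w => // i [_ _|j w /(_ isT) [t tw tE] _].
  by exists (Leaf i); rewrite ?magma_wt_leaf.
exists (Node t (Leaf i)); last by rewrite /= -tE.
by rewrite magma_wt_node tw magma_wt_leaf addrC -wwt_cat.
Qed.

Lemma lact_dynkin_ne t w : w != [::] -> lact t dynkin w = bracket (dynkin w) (lie_eval t).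
Proof.
elim: t w => [i|l IHl r IHr] w wN /=; first exact: dynkin_cons.
have H (a b : magma 'I_n) : (forall w,
  w != [::] -> lact a dynkin w = bracket (dynkin w) (lie_eval a)) ->
  (forall w, w != [::] -> lact b dynkin w = bracket (dynkin w) (lie_eval b)) ->
  lact a (lact b dynkin) w = bracket (bracket (dynkin w) (lie_eval a)) (lie_eval b).
  move=> Ha Hb; rewrite (lact_ext a w Hb).
  rewrite (lact_comp (h := fun u => bracket u (lie_eval b))) ?Ha //.
  by move=> x y; rewrite bracketDl bracketNl.
rewrite !H // [RHS]bracket_derivation.
by rewrite [bracket (lie_eval l) (bracket _ _)]bracketC.
Qed.

(** The Dynkin-Specht-Wever identity. On nonempty words a bracketing acts on [dynkin] as a right
    bracket, so the two halves of the commutator of l and r contribute ht l and ht r times the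
    bracket of l and r. *)
Lemma lact_dynkin t : lact t dynkin [::] = (ht (magma_wt t))%:R *: lie_eval t.
Proof.
elim: t => [i|l IHl r IHr].
  by rewrite magma_wt_leaf ht_wwt /= scale1r.
have H (a b : magma 'I_n) : lact a dynkin [::] = (ht (magma_wt a))%:R *: lie_eval a ->
  lact a (lact b dynkin) [::] = (ht (magma_wt a))%:R *: bracket (lie_eval a) (lie_eval b).
  move=> Ha; rewrite (lact_ext a (f := lact b dynkin) (g :=
    fun w => bracket (dynkin w) (lie_eval b))).
    rewrite (lact_comp (h := fun u => bracket u (lie_eval b))) ?Ha ?bracketZl //.
    by move=> x y; rewrite bracketDl bracketNl.
  exact: lact_dynkin_ne.
rewrite /= !H // [bracket (lie_eval r) _]bracketC scalerN opprK -scalerDl -natrD.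
by rewrite -htD -magma_wt_node.
Qed.

Hypothesis g_comm : forall i j, ~~ e i j -> bracket (g i) (g j) = 0.

Lemma bracket_disconnected (l r : magma 'I_n) :
  (forall i j, (0 < magma_wt l i)%N -> (0 < magma_wt r j)%N -> ~~ e i j) ->
  bracket (lie_eval l) (lie_eval r) = 0.
Proof.
move=> H; apply: bracket_eval0 => j rj; rewrite bracketC.
rewrite bracket_eval0 ?oppr0 // => i li; rewrite bracketC g_comm ?oppr0 //.
exact: H.
Qed.

(** When i and j commute, the Jacobi identity makes bracketing on the right by i and by j commute as
    well; if i and j are the innermost letters, both sides vanish. *)
Lemma dynkin_swap_inv : symmetric e -> swap_inv e dynkin.
Proof.
move=> e_sym; elim=> [|x a IH] i j b ij.
  rewrite !cat0s; case: b => [|y b] /=.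
    by rewrite [LHS]g_comm ?[RHS]g_comm // e_sym.
  set d := (X in bracket (bracket X _) _).
  have := bracket_derivation d (g i) (g j); rewrite (g_comm ij) bracket0r => /esym/eqP.
  by rewrite addr_eq0 => /eqP ->; rewrite [LHS]bracketC.
have ne (y z : 'I_n) : a ++ [:: y, z & b] != [::] by case: (a).
by rewrite !cat_cons (dynkin_cons x (ne i j)) (dynkin_cons x (ne j i)) IH.
Qed.

End LieEvaluation.

Section PcElements.
Variables (K : fieldType) (n : nat) (e : rel 'I_n).
Implicit Types (t : magma 'I_n) (v w : seq 'I_n).

Definition pc_elt t : pc_lie K e := pc_pi e (magma_elt K t).

Lemma pc_elt_node (l r : magma 'I_n) : pc_elt (Node l r) = bracket (pc_elt l) (pc_elt r).
Proof. by rewrite /pc_elt /pc_pi -bracket_magma_elt !lie_pi_bracket. Qed.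

(** Linear relations between bracketings in the quotient hold between their operators on invariant
    functions. *)
Lemma lact_pc_elt (V : lmodType K) t I (s : seq I) (P : pred I) (bt : I -> magma 'I_n)
    (c : I -> K) (f : seq 'I_n -> V) w : swap_inv e f ->
  pc_elt t = \sum_(b <- s | P b) c b *: pc_elt (bt b) ->
  lact t f w = \sum_(b <- s | P b) c b *: lact (bt b) f w.
Proof.
move=> fi tE; apply: subr0_eq.
pose x := magma_elt K t - \sum_(b <- s | P b) c b *: magma_elt K (bt b).
have x0 : pc_pi e x = 0.
  rewrite linearB linear_sum /= -[pc_pi e (magma_elt K t)]/(pc_elt t) tE.
  apply/eqP; rewrite subr_eq0; apply/eqP; apply: eq_bigr => b _; by rewrite linearZ.
rewrite -[RHS](lext_pc_pi w fi x0) lextB_elt lext_elt lext_sum; congr (_ - _).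
by apply: eq_bigr => b _; rewrite lextZ lext_elt.
Qed.

Lemma pc_eltE t : pc_elt t = lie_eval (fun i => pc_elt (Leaf i)) t.
Proof. by elim: t => //= l <- r <-; apply: pc_elt_node. Qed.

Lemma pc_elt_comm i j : ~~ e i j -> bracket (pc_elt (Leaf i)) (pc_elt (Leaf j)) = 0.
Proof.
move=> ij; rewrite /pc_elt /pc_pi -lie_pi_bracket; apply/lie_pi_eq0/Ideal_gen.
by exists i, j.
Qed.

End PcElements.

(** * Poincare-Birkhoff-Witt *)

(** The basis is extracted as a list of indices rather than of vectors, because [lact] needs
    bracketings and not their classes. *)
Lemma sub_basis (K : fieldType) (V : lmodType K) (T : eqType) (f : T -> V) (s : seq T) :
  exists b : seq T, [/\ uniq b, {subset b <= s},
    forall c : T -> K, \sum_(x <- b) c x *: f x = 0 -> forall x, x \in b -> c x = 0 &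
    forall x, x \in s -> exists c : T -> K, f x = \sum_(y <- b) c y *: f y].
Proof.
elim: s => [|x s [b [ub bs fb sb]]].
  by exists [::]; split=> // x; rewrite inE.
have [[c xE]|xNb] := pselect (exists c : T -> K, f x = \sum_(y <- b) c y *: f y).
  exists b; split=> // [y /bs|y]; rewrite inE; first by move=> ->; rewrite orbT.
  by case/orP=> [/eqP ->|/sb //]; exists c.
have xb : x \notin b.
  apply/negP => xb; apply: xNb; exists (fun y => (y == x)%:R).
  rewrite (bigD1_seq x) //= eqxx scale1r big1 ?addr0 // => y /negbTE ->.
  by rewrite scale0r.
exists (x :: b); split=> [|y|c|y]; rewrite ?inE /= ?xb ?ub //.
- by case/orP=> [->|/bs ->] //; rewrite orbT.
- rewrite big_cons => E.
  have c0 : c x = 0.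
    apply: contra_notP xNb => /eqP cx; exists (fun y => - (c x)^-1 * c y).
    under eq_bigr do rewrite -scalerA.
    rewrite -scaler_sumr; move/eqP: E; rewrite addrC addr_eq0 => /eqP ->.
    by rewrite scalerN scaleNr opprK scalerA mulVf // scale1r.
  move: E; rewrite c0 scale0r add0r => /fb cb y; rewrite inE => /orP [/eqP ->|/cb] //.
have bE a c : \sum_(z <- x :: b) (if z == x then a else c z) *: f z =
    a *: f x + \sum_(z <- b) c z *: f z.
  rewrite big_cons eqxx; congr (_ + _); apply: eq_big_seq => z zb.
  by rewrite ifN //; apply: contraNneq xb => <-.
case/orP=> [/eqP ->|/sb [c ->]].
  exists (fun z => if z == x then 1 else 0); rewrite (bE 1 (fun=> 0)) scale1r.
  by rewrite big1 ?addr0 // => z _; rewrite scale0r.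
by exists (fun z => if z == x then 0 else c z); rewrite (bE 0 c) scale0r add0r.
Qed.

Lemma sub_basis_is_basis (K : fieldType) (V : lmodType K) (T : eqType) (f : T -> V) (s b : seq T) :
  uniq b -> {subset b <= s} ->
  (forall c : T -> K, \sum_(x <- b) c x *: f x = 0 -> forall x, x \in b -> c x = 0) ->
  (forall x, x \in s -> exists c : T -> K, f x = \sum_(y <- b) c y *: f y) ->
  is_basis (lin_span [seq f x | x <- s]) [seq f x | x <- b].
Proof.
move=> ub bs fb sb.
have combE c : lin_comb [seq f x | x <- b] c = \sum_(x <- b) c (index x b) *: f x.
  case: b ub {bs fb sb} => [|x0 b'] ub; first by rewrite /lin_comb big_ord0 big_nil.
  rewrite /lin_comb size_map (big_nth x0) big_mkord; apply: eq_bigr => i _.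
  by rewrite (nth_map x0) // index_uniq.
split=> [c|].
  rewrite combE => /fb H i; rewrite size_map => ib.
  have x0 : T by case: b ib {bs fb sb ub combE H} => // x0.
  by have := H _ (mem_nth x0 ib); rewrite index_uniq.
apply/seteqP; split; apply: lin_span_min; try exact: lin_span0; try exact: lin_spanD;
  try exact: lin_spanZ; move=> _ /mapP [x xb ->].
  by apply/mem_lin_span/map_f/bs.
have [c ->] := sb x xb; rewrite big_seq.
apply: (big_ind (lin_span _)) => [||y yb]; [exact: lin_span0|exact: lin_spanD|].
exact/lin_spanZ/mem_lin_span/map_f.
Qed.

Definition tree_basis_of (K : fieldType) n (e : rel 'I_n) (a : {ffun 'I_n -> nat})
    (b : seq (magma 'I_n)) : Prop :=
  [/\ uniq b /\ size b = mult K e a, forall t, t \in b -> magma_wt t = a,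
    forall c : magma 'I_n -> K, \sum_(t <- b) c t *: pc_elt K e t = 0 ->
      forall t, t \in b -> c t = 0 &
    forall t, magma_wt t = a ->
      exists c : magma 'I_n -> K, pc_elt K e t = \sum_(s <- b) c s *: pc_elt K e s].

Lemma tree_basis_exists (K : fieldType) n (e : rel 'I_n) a :
  exists b, tree_basis_of K e a b.
Proof.
pose s := [seq t <- magma_enum n (ht a) | magma_wt t == a].
have [b [ub bs fb sb]] := sub_basis (pc_elt K e) s.
exists b; split=> //.
- split=> //; have B := sub_basis_is_basis ub bs fb sb.
  by rewrite /mult (@dimensionE _ _ _ [seq pc_elt K e x | x <- b]) ?size_map // pc_gradeE.
- by move=> t /bs; rewrite mem_filter => /andP [/eqP].
- by move=> t ta; apply: sb; rewrite mem_filter ta eqxx mem_magma_enum ?ta.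
Qed.

(** * Shuffle products of functions of words *)

Section Shuffle.
Variables (K : comNzRingType) (n : nat) (J : finType).
Implicit Types (F : J -> seq 'I_n -> K) (f : seq 'I_n -> K) (t : magma 'I_n).

Definition upd F j f : J -> seq 'I_n -> K := fun j' => if j' == j then f else F j'.

(* The product of functions dual to the coproduct for which letters are primitive. *)
Fixpoint shuffle F w : K :=
  match w with
  | [::] => \prod_j F j [::]
  | i :: w' => \sum_j shuffle (upd F j (fun v => F j (i :: v))) w'
  end.

Lemma updE F j f : upd F j f j = f. Proof. by rewrite /upd eqxx. Qed.
Lemma updN F j j' f : j' != j -> upd F j f j' = F j'.
Proof. by rewrite /upd => /negbTE ->. Qed.

Lemma updC F j j' f g : j != j' -> upd (upd F j f) j' g = upd (upd F j' g) j f.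
Proof.
move=> jj'; apply: funext => i; rewrite /upd.
by have [->|//] := eqVneq i j'; rewrite eq_sym (negbTE jj').
Qed.

Lemma upd_upd F j f g : upd (upd F j f) j g = upd F j g.
Proof. by apply: funext => i; rewrite /upd; case: eqP. Qed.

Lemma shuffleB F j f g w : shuffle (upd F j (fun v => f v - g v)) w =
  shuffle (upd F j f) w - shuffle (upd F j g) w.
Proof.
elim: w F f g => [|i w IH] F f g /=.
  have E h : \prod_j' upd F j h j' [::] = h [::] * \prod_(j' | j' != j) F j' [::].
    rewrite (bigD1 j) //= updE; congr (_ * _).
    by apply: eq_bigr => j' jj'; rewrite updN.
  by rewrite !E mulrBl.
rewrite -sumrB; apply: eq_bigr => j' _.
have [->|jj'] := eqVneq j' j; first by rewrite !updE !upd_upd IH.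
have j'j : j != j' by rewrite eq_sym.
by rewrite !(updN _ _ jj') !(updC _ _ _ j'j) IH.
Qed.

Lemma shuffle0 F j w : shuffle (upd F j (fun=> 0)) w = 0.
Proof.
rewrite (_ : (fun=> 0) = fun v => (0 : K) - 0) ?shuffleB ?subrr //.
Qed.

(* Bracketings act on shuffle products by derivations. *)
Lemma lact_shuffle t F w :
  lact t (shuffle F) w = \sum_j shuffle (upd F j (lact t (F j))) w.
Proof.
elim: t F w => [//|l IHl r IHr] F w.
pose G a b j j' := shuffle (upd (upd F j (lact b (F j))) j' (lact a (upd F j (lact b (F j)) j'))) w.
have H (a b : magma 'I_n) : (forall F w,
  lact a (shuffle F) w = \sum_j shuffle (upd F j (lact a (F j))) w) ->
  (forall F w, lact b (shuffle F) w = \sum_j shuffle (upd F j (lact b (F j))) w) ->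
  lact a (lact b (shuffle F)) w = \sum_j \sum_j' G a b j j'.
  move=> Ha Hb; rewrite (eq_lact a (Hb F)).
  transitivity (\sum_j lact a (shuffle (upd F j (lact b (F j)))) w).
    by rewrite lact_sumr.
  by apply: eq_bigr => j _; rewrite Ha.
rewrite /= (H l r) // (H r l) // [X in _ - X]exchange_big -sumrB.
(* For j' different from j, both orders let r act on slot j and l on slot j', and cancel; the
   diagonal terms form the commutator. *)
apply: eq_bigr => j _; rewrite -sumrB (bigD1 j) //= big1 => [|j' jj'].
  by rewrite addr0 /G !updE !upd_upd -shuffleB.
have j'j : j != j' by rewrite eq_sym.
by rewrite /G (updN _ _ jj') (updN _ _ j'j) (updC _ _ _ j'j) subrr.
Qed.

(** At the front of a word, the difference between the two orders is the action of the bracketing of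
    j and i, a derivation that kills every factor. *)
Lemma shuffle_swap_inv (e : rel 'I_n) F : (forall j, swap_inv e (F j)) -> swap_inv e (shuffle F).
Proof.
move=> Fi a; elim: a F Fi => [|x a IH] F Fi i j b ij.
  apply/eqP; rewrite -subr_eq0.
  rewrite -[_ - _]/(lact (Node (Leaf j) (Leaf i)) (shuffle F) b) lact_shuffle big1 // => k _.
  rewrite (_ : lact _ _ = fun=> 0) ?shuffle0 //; apply: funext => v /=.
  by rewrite (Fi k [::] i j v ij) subrr.
apply: eq_bigr => k _; apply: IH ij => k'; rewrite /upd; case: eqP => // _.
exact/swap_inv_cons/Fi.
Qed.
End Shuffle.

(** * Composites of bracketings as operators *)

Section IteratedAction.
Variable n : nat.
Implicit Types (t : magma 'I_n) (ts : seq (magma 'I_n)) (v w : seq 'I_n).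

Lemma eq_foldr_lact (V : zmodType) ts (f g : seq 'I_n -> V) :
  f =1 g -> foldr (@lact n V) f ts =1 foldr (@lact n V) g ts.
Proof. by move=> fg; elim: ts => //= t ts IH; apply: eq_lact. Qed.

Lemma foldr_lact_local (V : zmodType) ts (f g : seq 'I_n -> V) w :
  (forall v, wwt v = \sum_(t <- ts) magma_wt t + wwt w -> f v = g v) ->
  foldr (@lact n V) f ts w = foldr (@lact n V) g ts w.
Proof.
elim: ts w => [|t ts IH] w fg /=; first by apply: fg; rewrite big_nil add0r.
apply: lact_local => v vE; apply: IH => u uE; apply: fg.
by rewrite uE vE big_cons addrA; congr (_ + _); rewrite addrC.
Qed.

Lemma foldr_lact_sum (V : zmodType) I (s : seq I) (P : pred I) (F : I -> seq 'I_n -> V) ts w :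
  foldr (@lact n V) (fun v => \sum_(i <- s | P i) F i v) ts w =
  \sum_(i <- s | P i) foldr (@lact n V) (F i) ts w.
Proof.
by elim: ts w => //= t ts IH w; rewrite (eq_lact t IH) lact_sumr.
Qed.

Lemma foldr_lactB (V : zmodType) (f g : seq 'I_n -> V) ts w :
  foldr (@lact n V) (fun v => f v - g v) ts w =
  foldr (@lact n V) f ts w - foldr (@lact n V) g ts w.
Proof.
by elim: ts w => //= t ts IH w; rewrite (eq_lact t IH) lactB.
Qed.

Lemma foldr_lactM (K : pzRingType) (c : K) f ts w :
  foldr (@lact n K) (fun v => c * f v) ts w = c * foldr (@lact n K) f ts w.
Proof.
elim: ts w => //= t ts IH w; rewrite (eq_lact t IH).
by apply: (lact_comp (h := fun x => c * x)) => x y; rewrite mulrBr.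
Qed.

Lemma foldr_lact_lin (K : pzRingType) I (s : seq I) (P : pred I) (c : I -> K) F ts w :
  foldr (@lact n K) (fun v => \sum_(i <- s | P i) c i * F i v) ts w =
  \sum_(i <- s | P i) c i * foldr (@lact n K) (F i) ts w.
Proof. by rewrite foldr_lact_sum; apply: eq_bigr => i _; rewrite foldr_lactM. Qed.

Lemma foldr_lact_swap_inv (e : rel 'I_n) (V : zmodType) ts (f : seq 'I_n -> V) :
  swap_inv e f -> swap_inv e (foldr (@lact n V) f ts).
Proof. by move=> fi; elim: ts => //= t ts; apply: lact_swap_inv. Qed.

(** The outermost letter is prefixed first, whence the reversal. Composites of single letters thus
    recover all values of f. *)
Lemma foldr_lact_word (V : zmodType) (f : seq 'I_n -> V) w v :
  foldr (@lact n V) f (map (@Leaf _) w) v = f (rev w ++ v).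
Proof. by elim: w v => //= i w IH v; rewrite IH rev_cons cat_rcons. Qed.

End IteratedAction.

Lemma perm_swap_ind (T : eqType) (P : seq T -> Prop) s s' :
  (forall a x y b, P (a ++ x :: y :: b) -> P (a ++ y :: x :: b)) -> perm_eq s s' -> P s -> P s'.
Proof.
move=> sw ss' Ps; suff H c : P (c ++ s) -> P (c ++ s') by apply: (H [::]).
elim: s' s ss' c {Ps} => [|x s' IH] s ss' c; first by rewrite (perm_nilP ss').
have /mem_split [a [b [sE _]]] : x \in s by rewrite (perm_mem ss') mem_head.
rewrite sE => Ps; rewrite -cat_rcons; apply: (IH (a ++ b)).
  by rewrite -(perm_cons x) -(permPr ss') sE -cat1s perm_catCA.
rewrite cat_rcons; elim/last_ind: a b Ps {sE ss'} => //= a y IHa b.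
rewrite cat_rcons catA => /sw; rewrite -catA => /IHa.
by rewrite cat_rcons.
Qed.

(** * Pairing composites of bracketings with shuffle products *)

Section Pairing.
Variables (K : comNzRingType) (n : nat).

(** By the Leibniz rule each bracketing hits one slot, so in every term some slot that vanishes at
    the empty word stays untouched. *)
Lemma foldr_lact_shuffle_short (J : finType) (F : J -> seq 'I_n -> K) (us : seq (magma 'I_n)) :
  (size us < #|[pred j | F j [::] == 0%R]|)%N -> foldr (@lact n K) (shuffle F) us [::] = 0.
Proof.
elim/last_ind: us F => [|us u IH] F.
  by move=> /card_gt0P [j]; rewrite inE => /eqP Fj; rewrite /= (bigD1 j) //= Fj mul0r.
rewrite size_rcons => sz; rewrite foldr_rcons.
rewrite (eq_foldr_lact us (lact_shuffle u F)) foldr_lact_sum big1 // => j _.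
apply: IH; rewrite -ltnS; apply: leq_trans sz _.
rewrite (cardD1 j) -addn1 addnC leq_add ?leq_b1 //.
apply: subset_leq_card; apply/subsetP => j'; rewrite !inE => /andP [jj' Fj'].
by rewrite updN.
Qed.

Variables (B : finType) (bt : B -> magma 'I_n) (f : B -> seq 'I_n -> K).
Hypotheses (f0 : forall b, f b [::] = 0)
  (fE : forall b b', lact (bt b) (f b') [::] = (b == b')%:R).

(* The pairing counts the bijections from us to the labels; slots with lab j = None
   have already been hit. *)
Lemma foldr_lact_shuffle_exact (J : finType) (lab : J -> option B) (F : J -> seq 'I_n -> K)
    (us : seq B) :
  (forall j, if lab j is Some b then F j = f b else F j [::] = 1) ->
  size us = #|[pred j | lab j]| ->
  exists2 p : nat, foldr (@lact n K) (shuffle F) (map bt us) [::] = p%:R &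
    (0 < p)%N = [forall b, count_mem b us == #|[pred j | lab j == Some b]|].
Proof.
elim/last_ind: us lab F => [|us u IH] lab F labF.
  move=> /esym/card0_eq lab0; exists 1%N => /=.
    rewrite big1 // => j _; have := labF j.
    by have := lab0 j; rewrite inE; case: (lab j).
  apply/esym/forallP => b; apply/eqP/esym/eq_card0 => j.
  by have := lab0 j; rewrite !inE; case: (lab j).
rewrite size_rcons => sz.
have cnt j : lab j = Some u -> forall b,
  #|[pred j' | lab j' == Some b]| =
    ((u == b) + #|[pred j' | (if j' == j then None else lab j') == Some b]|)%N.
  move=> ju b; rewrite (cardD1 j) !inE ju; congr (_ + _)%N.
  by apply: eq_card => j'; rewrite !inE; case: eqP.
have : forall j, exists p : nat,
    foldr (@lact n K) (shuffle (upd F j (lact (bt u) (F j)))) (map bt us) [::] = p%:R /\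
    (0 < p)%N = (lab j == Some u) && [forall b,
      count_mem b (rcons us u) == #|[pred j | lab j == Some b]|].
  move=> j; have := labF j; case labj : (lab j) => [b|] Fj; last first.
    (* Acting on a slot already hit is a waste: the labelled slots still vanish at the empty word
       and outnumber the remaining bracketings. *)
    exists 0%N; split=> //; apply: foldr_lact_shuffle_short.
    rewrite size_map sz; apply: subset_leq_card; apply/subsetP => j'; rewrite !inE => labj'.
    rewrite updN; last by apply: contraTneq labj' => ->; rewrite labj.
    by have := labF j'; case: (lab j') labj' => // b _ ->; rewrite f0.
  have [E|bu] := eqVneq b u; last first.
    (* Acting on a slot with another label gives 0 at the empty word by [fE], so again all labelled
       slots vanish there. *)
    exists 0%N; split=> //; last by rewrite eqE /= (negbTE bu).
    apply: foldr_lact_shuffle_short.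
    rewrite size_map sz; apply: subset_leq_card; apply/subsetP => j'; rewrite !inE => labj'.
    have [->|jj'] := eqVneq j' j; first by rewrite updE Fj fE [u == b]eq_sym (negbTE bu).
    by rewrite updN //; have := labF j'; case: (lab j') labj' => // b' _ ->; rewrite f0.
  move: labj Fj; rewrite {}E => labj Fj.
  have [||p pE p0] := IH (fun j' => if j' == j then None else lab j') (upd F j (lact (bt u) (F j))).
  - move=> j'; have [->|jj'] := eqVneq j' j; first by rewrite updE Fj fE eqxx.
    by rewrite updN //; apply: labF.
  - apply: succn_inj; rewrite sz (cardD1 j) !inE labj; congr (_ + _)%N.
    by apply: eq_card => j'; rewrite !inE; case: eqP.
  exists p; split=> //; rewrite p0 eqxx /=; apply: eq_forallb => c.
  by rewrite (cnt j) // -cats1 count_cat /= addn0 addnC eqn_add2l.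
move=> /choice [p pP]; exists (\sum_j p j)%N.
  rewrite map_rcons foldr_rcons (eq_foldr_lact _ (lact_shuffle _ _)) foldr_lact_sum natr_sum.
  by apply: eq_bigr => j _; case: (pP j).
rewrite lt0n sum_nat_eq0; apply/forallPn/idP => [[j]|H].
  by rewrite /= -lt0n; case: (pP j) => _ -> /andP [].
have : (0 < #|[pred j | lab j == Some u]|)%N.
  by move/forallP: (H) => /(_ u) /eqP <-; rewrite -cats1 count_cat /= eqxx addnC.
move=> /card_gt0P [j]; rewrite inE => ju; exists j.
by rewrite /= -lt0n; case: (pP j) => _ ->; rewrite ju.
Qed.

(** The value is retained only as a natural number with a criterion for positivity, which in
    characteristic zero decides whether it is nonzero. *)
Lemma foldr_lact_pairing (us vs : seq B) : size us = size vs ->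
  exists2 p : nat,
    foldr (@lact n K) (shuffle (fun j : 'I_(size vs) => f (tnth (in_tuple vs) j))) (map bt us) [::]
      = p%:R & (0 < p)%N = perm_eq us vs.
Proof.
move=> sz; have [||p pE p0] := @foldr_lact_shuffle_exact _
    (fun j : 'I_(size vs) => Some (tnth (in_tuple vs) j))
    (fun j : 'I_(size vs) => f (tnth (in_tuple vs) j)) us; first by [].
  by rewrite sz -[LHS]card_ord; apply: eq_card.
exists p; rewrite // p0.
have cE b : #|[pred j : 'I_(size vs) | Some (tnth (in_tuple vs) j) == Some b]| = count_mem b vs.
  rewrite -[in RHS](map_tnth_enum (in_tuple vs) : _ = vs) count_map cardE size_filter enumT.
  by apply: eq_count => j; rewrite !inE.
apply/forallP/idP => [H|/permP H b]; last by rewrite cE H.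
by apply/allP => b _ /=; rewrite -cE; apply: H.
Qed.

End Pairing.

Lemma card_le_of_free (K : fieldType) (X Y : finType) (P : X -> Y -> K) :
  (forall c : X -> K, (forall y, \sum_x c x * P x y = 0) -> forall x, c x = 0) -> (#|X| <= #|Y|)%N.
Proof.
move=> H; rewrite leqNgt; apply/negP => lt.
pose M := \matrix_(i < #|X|, j < #|Y|) P (enum_val i) (enum_val j).
have : kermx M != 0.
  by rewrite -mxrank_eq0 mxrank_ker subn_eq0 -ltnNge; apply: leq_ltn_trans lt; exact: rank_leq_col.
move=> /rowV0Pn [v /sub_kermxP vM] /eqP; apply; apply/rowP => i; rewrite mxE.
rewrite -(enum_valK i); apply: (H (fun x => v 0 (enum_rank x))) => y.
have := congr1 (fun A : 'rV_(#|Y|) => A 0 (enum_rank y)) vM; rewrite !mxE => vMy; rewrite -[RHS]vMy.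
rewrite (reindex (@enum_val X X)) /=; last by apply: onW_bij; apply: enum_val_bij.
by apply: eq_bigr => j _; rewrite enum_valK !mxE enum_rankK.
Qed.

Lemma sum_scale_delta (K : nzRingType) (V : lmodType K) (B : finType) (P : pred B) k b (g : B ->
  V) :
  P b -> \sum_(b' | P b') (k * (b == b')%:R) *: g b' = k *: g b.
Proof.
move=> Pb; rewrite (bigD1 b) //= eqxx mulr1 big1 ?addr0 // => b' /andP [_ bb'].
by rewrite eq_sym (negbTE bb') mulr0 scale0r.
Qed.

(** * Ordered monomials in graded bases, paired with traces *)

Section PBW.
Variables (K : numFieldType) (n : nat) (e : rel 'I_n).
Hypotheses (e_sym : symmetric e) (e_irr : irreflexive e).
Variables (B : finType) (bt : B -> magma 'I_n) (N : nat).
Local Notation bwt b := (magma_wt (bt b)).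
Local Notation pc := (pc_elt K e).
Hypotheses (bt_lt : forall b, (ht (bwt b) < N)%N)
  (bt_span : forall t, (ht (magma_wt t) < N)%N ->
    exists c : B -> K, pc t = \sum_(b | bwt b == magma_wt t) c b *: pc (bt b))
  (bt_free : forall a (c : B -> K),
    \sum_(b | bwt b == a) c b *: pc (bt b) = 0 -> forall b, bwt b = a -> c b = 0).

(** The dual function of b0 is the b0-coordinate of the Dynkin element of a word, divided by the
    eigenvalue ht a of the Dynkin operator on the degree a of b0, and 0 on words of other
    weights. *)
Lemma dual_functions : exists f : B -> seq 'I_n -> K,
  [/\ forall b, swap_inv e (f b), forall b, f b [::] = 0 &
      forall b b', lact (bt b) (f b') [::] = (b == b')%:R].
Proof.
pose D := dynkin (fun i => pc (Leaf i)).
have Di : swap_inv e D by apply: dynkin_swap_inv => //; apply: pc_elt_comm.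
have htN0 b : (ht (bwt b))%:R != 0 :> K by rewrite pnatr_eq0 -lt0n ht_magma_gt0.
suff H b0 : exists g : seq 'I_n -> K, [/\ swap_inv e g, g [::] = 0 &
    forall b, lact (bt b) g [::] = (b == b0)%:R].
  have [f fP] := choice H.
  by exists f; split=> [b|b|b b']; [case: (fP b)|case: (fP b)|case: (fP b') => _ _ ->].
pose a := bwt b0.
pose L (c : {ffun B -> K}) : pc_lie K e := \sum_(b | bwt b == a) c b *: pc (bt b).
have LB : {morph L : x y / x - y}.
  move=> x y; rewrite -sumrB; apply: eq_bigr => b _.
  by rewrite !ffunE scalerBl.
(* [C] is a section of [L] on its image, with default 0 elsewhere. Coordinates are compared after
   applying [L], which is additive and, by [bt_free], determines them on the labels of weight a. *)
pose C (u : pc_lie K e) : {ffun B -> K} :=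
  if pselect (exists c, u = L c) is left p then projT1 (cid p) else 0.
have CE w : wwt w = a -> L (C (D w)) = D w.
  move=> wa; rewrite /C; case: pselect => [p|[]]; first by case: (cid p) => /= c ->.
  have [|t tw tE] := @dynkin_eval _ _ _ (fun i => pc (Leaf i)) w.
    by rewrite -wwt_eq0 wa -ht_eq0 -lt0n ht_magma_gt0.
  have [|c cE] := bt_span (t := t); first by rewrite tw wa; apply: bt_lt.
  exists (finfun c); rewrite /D tE -pc_eltE cE tw wa.
  by apply: eq_bigr => b _; rewrite ffunE.
pose G w : {ffun B -> K} := if wwt w == a then C (D w) else 0.
have sw u i j (v : seq 'I_n) : wwt (u ++ i :: j :: v) = wwt (u ++ j :: i :: v).
  by apply/ffunP => k; rewrite !ffunE !count_cat /=; congr (_ + _)%N; rewrite addnCA.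
have Gi : swap_inv e G by move=> u i j v ij; rewrite /G sw Di.
exists (fun w => (ht a)%:R^-1 * G w b0); split.
- by move=> u i j v ij /=; rewrite Gi.
- rewrite /G wwt_nil; case: eqP => [a0|_]; last by rewrite ffunE mulr0.
  by have := ht_magma_gt0 (bt b0); rewrite -/a -a0 ht0.
move=> b; rewrite (lact_comp (h := fun x : {ffun B -> K} => (ht a)%:R^-1 * x b0)); last first.
  by move=> x y; rewrite !ffunE mulrBr.
have [ba|ba] := eqVneq (bwt b) a; last first.
  rewrite (lact_local (g := fun=> 0)) => [|v]; last first.
    by rewrite wwt_nil addr0 /G => ->; rewrite (negbTE ba).
  rewrite lact0 ffunE mulr0; case: eqP => // bb0.
  by move: ba; rewrite bb0 eqxx.
have : L (lact (bt b) G [::]) = (ht a)%:R *: pc (bt b).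
  rewrite -(lact_comp (h := L)) // pc_eltE -ba -lact_dynkin; apply: lact_local => v.
  by rewrite wwt_nil addr0 ba => va; rewrite /G va eqxx CE.
set x := lact _ _ _ => xE.
suff -> : x b0 = (ht a)%:R * (b == b0)%:R by rewrite mulrA mulVf ?mul1r // htN0.
apply/eqP; rewrite -subr_eq0; apply/eqP.
pose c b' := x b' - (ht a)%:R * (b == b')%:R.
apply: (@bt_free a c) => //.
transitivity (L x - \sum_(b' | bwt b' == a) ((ht a)%:R * (b == b')%:R) *: pc (bt b')).
  by rewrite -sumrB; apply: eq_bigr => b' _; rewrite scalerBl.
apply/eqP; rewrite xE subr_eq0; apply/eqP.
exact/esym/sum_scale_delta/eqP.
Qed.

(** The monomial with exponents A, its factors in the order of the enumeration of B. Since every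
    factor has positive height, exponents below N reach all monomials of height below N. *)
Definition mon (A : {ffun B -> 'I_N}) : seq B := flatten [seq nseq (A b) b | b <- enum B].

Lemma count_mon A b : count_mem b (mon A) = A b.
Proof.
rewrite count_flatten -map_comp sumnE big_map big_enum (bigD1 b) //=.
by rewrite count_nseq /= eqxx mul1n big1 ?addn0 // => b' /negbTE bb'; rewrite count_nseq /= bb'.
Qed.

Lemma sum_seq_count (V : nmodType) (s : seq B) (F : B -> V) :
  \sum_(b <- s) F b = \sum_b F b *+ count_mem b s.
Proof.
elim: s => [|x s IH]; first by rewrite big_nil big1.
rewrite big_cons IH (bigD1 x) //= [RHS](bigD1 x) //= eqxx mulrS addrA; congr (_ + _).
by apply: eq_bigr => b /negbTE; rewrite eq_sym => ->.
Qed.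

Definition mons (m : {ffun 'I_n -> nat}) : {set {ffun B -> 'I_N}} :=
  [set A : {ffun B -> 'I_N} | \sum_b bwt b *+ A b == m].

Lemma sum_mon A m : A \in mons m -> \sum_(t <- map bt (mon A)) magma_wt t = m.
Proof.
rewrite inE => /eqP <-; rewrite big_map (sum_seq_count (mon A)).
by apply: eq_bigr => b _; rewrite count_mon.
Qed.

Local Notation ev ts g := (foldr (@lact n K) g ts [::]).

(** The pairing is triangular in length. A longest monomial with nonzero coefficient is paired with
    the shuffle product of the dual functions of its factors: shorter monomials and other monomials
    of the same length give 0, while the monomial itself gives a positive integer. *)
Lemma mon_free m (c : {ffun B -> 'I_N} -> K) :
  (forall g, swap_inv e g -> \sum_(A in mons m) c A * ev (map bt (mon A)) g = 0) ->
  forall A, A \in mons m -> c A = 0.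
Proof.
move=> cg A Am; apply/eqP/negPn/negP => cA.
pose P A' := (A' \in mons m) && (c A' != 0).
have PA : P A by rewrite /P Am.
case: (arg_maxnP (fun A' => size (mon A')) PA) => {PA}A0 /andP [A0m cA0] A0max.
have [f [fi f0 fE]] := dual_functions.
pose F := shuffle (fun j : 'I_(size (mon A0)) => f (tnth (in_tuple (mon A0)) j)).
have := cg F (shuffle_swap_inv (fun j => fi _)).
have [//|p pE p0] := foldr_lact_pairing f0 fE (us := mon A0) (vs := mon A0).
rewrite (bigD1 A0) //= [X in _ + X]big1 => [|A' /andP [A'm A'N]].
  move/eqP; rewrite addr0 /F pE mulf_eq0 (negbTE cA0) pnatr_eq0 -leqn0 leqNgt p0.
  by rewrite perm_refl.
have [->|cA'] := eqVneq (c A') 0; first by rewrite mul0r.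
have /= := A0max A'; rewrite /P A'm cA' => /(_ isT); rewrite leq_eqVlt => /orP [/eqP sz|sz].
  have [//|p' p'E p'0] := foldr_lact_pairing f0 fE (us := mon A') (vs := mon A0).
  rewrite /F p'E; suff -> : p' = 0%N by rewrite mulr0.
  apply/eqP; rewrite -leqn0 leqNgt p'0; apply: contra A'N => /permP pm.
  by apply/eqP/ffunP => b; apply/val_inj; rewrite /= -!count_mon pm.
rewrite foldr_lact_shuffle_short ?mulr0 // size_map; apply: leq_trans sz _.
rewrite -[X in (X <= _)%N]card_ord; apply: subset_leq_card; apply/subsetP => j _.
by rewrite inE f0.
Qed.

(** Straightening, in dual form. Exchanging two neighbouring factors costs a product with one factor
    fewer, namely the one containing their bracket, so induction on the length allows free
    reordering. *)
Lemma ev_vanish m (g : seq 'I_n -> K) : swap_inv e g -> (ht m < N)%N ->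
  (forall A, A \in mons m -> ev (map bt (mon A)) g = 0) ->
  forall ts, \sum_(t <- ts) magma_wt t = m -> ev ts g = 0.
Proof.
move=> gi mN g0 ts; have [d] := ubnP (size ts).
elim: d ts => // d IHd ts; rewrite ltnS leq_eqVlt => /orP [/eqP sz tsm|/IHd //].
have IH ts' : (size ts' < d)%N -> \sum_(t <- ts') magma_wt t = m -> ev ts' g = 0.
  exact: IHd.
pose P us := size us = d -> \sum_(t <- us) magma_wt t = m -> ev us g = 0.
have swapP a x y b : P (a ++ x :: y :: b) -> P (a ++ y :: x :: b).
  move=> Pxy szb wtb.
  have szb' : size (a ++ x :: y :: b) = d by rewrite -szb !size_cat.
  have wtb' : \sum_(t <- a ++ x :: y :: b) magma_wt t = m.
    by rewrite -wtb !big_cat !big_cons /=; congr (_ + _); rewrite addrCA.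
  have := IH (a ++ Node x y :: b).
  rewrite -szb !size_cat /= ltn_add2l ltnSn => /(_ isT).
  rewrite big_cat big_cons magma_wt_node -wtb' [in RHS]big_cat !big_cons /= !addrA => /(_ erefl).
  rewrite foldr_cat /= foldr_lactB -!/(foldr _ _ (_ :: _)) => /subr0_eq E.
  by have := Pxy szb' wtb'; rewrite !foldr_cat /= -E.
have Pbt (us : seq B) : P (map bt us).
  move=> szu wtu.
  have cN b : (count_mem b us < N)%N.
    apply: leq_ltn_trans mN; rewrite -wtu ht_sum big_map -sum1_count big_mkcond.
    by apply: leq_sum => b' _; case: ifP => // _; apply: ht_magma_gt0.
  pose A := [ffun b => Ordinal (cN b)].
  have pm : perm_eq (mon A) us.
    by apply/allP => b _ /=; rewrite count_mon ffunE.
  apply: (perm_swap_ind swapP (perm_map bt pm)) => // _ wtA.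
  by apply: g0; rewrite inE -wtA big_map (sum_seq_count (mon A)); apply/eqP/eq_bigr => b _;
    rewrite count_mon.
(* The factors are expanded in the basis one at a time from the left; [bs] collects those already
   expanded. *)
suff H us (bs : seq B) : P (map bt bs ++ us) by apply: (H ts [::]).
elim: us bs => [|u us IHu] bs; first by rewrite cats0; apply: Pbt.
move=> szu wtu; have [|c cE] := bt_span (t := u).
  apply: leq_ltn_trans mN; rewrite -wtu big_cat big_cons /= !htD.
  by rewrite addnCA leq_addr.
have gi' := foldr_lact_swap_inv us gi.
have uE : lact u (foldr (@lact n K) g us) =1
    fun w => \sum_(b | bwt b == magma_wt u) c b * lact (bt b) (foldr (@lact n K) g us) w.
  by move=> w; apply: (@lact_pc_elt _ _ _ K^o u _ _ _ bt c _ w gi' cE).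
rewrite foldr_cat /= (eq_foldr_lact _ uE) foldr_lact_lin big1 // => b /eqP bu.
rewrite -[X in _ * X]/(ev (map bt bs) (foldr (@lact n K) g (bt b :: us))) -foldr_cat.
rewrite -cat_rcons -map_rcons IHu ?mulr0 //.
  by rewrite map_rcons cat_rcons -szu !size_cat.
by rewrite map_rcons cat_rcons -wtu !big_cat !big_cons bu.
Qed.

Lemma trace_decomposition m (g : seq 'I_n -> K) w : swap_inv e g -> wwt w = m ->
  g w = \sum_(t <- traces e m) g t * (treq e w t)%:R.
Proof.
move=> gi wm; rewrite (bigD1_seq (canon e w)) ?traces_uniq ?canon_traces //=.
rewrite treq_canon mulr1 -(swap_inv_treq e_sym gi (treq_canon e w)).
rewrite big_seq_cond big1 ?addr0 // => t /andP [+ tw].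
rewrite mem_traces => /andP [_ /eqP tc]; case: canonP => [E|_]; last by rewrite mulr0.
by move: tw; rewrite E tc eqxx.
Qed.

(* Poincare-Birkhoff-Witt: the pairing of the ordered monomials in the basis bt with the
   indicator functions of traces is nondegenerate on both sides. *)
Lemma card_traces m : (ht m < N)%N -> size (traces e m) = #|mons m|.
Proof.
move=> mN; set s := traces e m.
pose X : finType := {A | A \in mons m}; pose Y : finType := 'I_(size s).
have di t : swap_inv e (fun w => (treq e w t)%:R : K).
  move=> a i j b ij; congr (nat_of_bool _)%:R.
  have H := treq_swap e_sym a b ij; apply/idP/idP; apply: treq_trans => //.
  by rewrite treq_sym.
pose P (A : X) (y : Y) := ev (map bt (mon (val A))) (fun w => (treq e w (tnth (in_tuple s) y))%:R).
have cX : #|X| = #|mons m| by rewrite card_sig.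
have cY : #|Y| = size s by apply: card_ord.
apply/eqP; rewrite -cX -cY eqn_leq; apply/andP; split.
  (* An invariant function killed by all ordered monomials of weight m vanishes on words of weight
     m: straightening is applied to the single letters of a trace. *)
  apply: (card_le_of_free (P := fun y A => P A y)) => c cP y.
  pose g w := \sum_y c y * (treq e w (tnth (in_tuple s) y))%:R.
  have gi : swap_inv e g.
    by move=> a i j b ij; apply: eq_bigr => y' _; rewrite (di _ a i j b ij).
  have g0 : forall A, A \in mons m -> ev (map bt (mon A)) g = 0.
    by move=> A Am; rewrite foldr_lact_lin; apply: (cP (Sub A Am)).
  have ty : tnth (in_tuple s) y \in traces e m by apply: mem_tnth.
  have := ev_vanish gi mN g0 (ts := map (@Leaf _) (rev (tnth (in_tuple s) y))).
  rewrite foldr_lact_word revK cats0 sum_wt_leaf.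
  have -> : wwt (rev (tnth (in_tuple s) y)) = m.
    have := ty; rewrite mem_traces => /andP [/eqP tm _].
    by rewrite -[RHS]tm; apply/ffunP => i; rewrite !ffunE count_rev.
  move=> /(_ erefl); rewrite /g (bigD1 y) //= treq_refl mulr1 big1 ?addr0 // => y' y'y.
  case: canonP => [|_]; last by rewrite mulr0.
  have ty' : tnth (in_tuple s) y' \in traces e m by apply: mem_tnth.
  move: ty ty'; rewrite !mem_traces => /andP [_ /eqP ->] /andP [_ /eqP ->] /eqP.
  rewrite !(tnth_nth [::]) nth_uniq ?traces_uniq ?ltn_ord // => /eqP/val_inj E.
  by move: y'y; rewrite E eqxx.
(* A relation between monomials that holds on the indicators of traces holds on every invariant
   function, which in weight m is a combination of such indicators. *)
apply: (card_le_of_free (P := P)) => c cP A.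
pose c' (A : {ffun B -> 'I_N}) := if insub A is Some x then c x else 0.
have c'E x : c' (val x) = c x by rewrite /c' valK.
rewrite -c'E; apply: (@mon_free m) (valP A) => g gi; rewrite big_sub.
have gE w : wwt w = m -> g w = \sum_(y : Y) g (tnth (in_tuple s) y) * (treq e w (tnth (in_tuple
  s) y))%:R.
  by move=> wm; rewrite (trace_decomposition gi wm) big_tnth.
transitivity (\sum_(x : X) \sum_(y : Y) g (tnth (in_tuple s) y) * (c x * P x y)).
  apply: eq_bigr => x _; rewrite c'E.
  rewrite (foldr_lact_local (g := fun w => \sum_(y : Y) g (tnth (in_tuple s) y) * (treq e w (tnth
    (in_tuple s) y))%:R)).
    by rewrite foldr_lact_lin mulr_sumr; apply: eq_bigr => y _; rewrite mulrCA.
  by move=> v; rewrite wwt_nil addr0 (sum_mon (valP x)); apply: gE.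
by rewrite exchange_big big1 // => y _; rewrite -mulr_sumr cP mulr0.
Qed.

End PBW.

(** * Power series and the Euler derivation *)

Section WeightSeries.
Variables (R : comNzRingType) (n : nat).
Implicit Types (a m : {ffun 'I_n -> nat}) (f : {ffun 'I_n -> nat} -> R).

(** Multiplication by x^a, on coefficients. *)
Definition shift a f m : R := if wle a m then f (wsub m a) else 0.

Lemma wle_sub a b m : wle a m -> wle b (wsub m a) = wle (b + a) m.
Proof.
move=> am; apply/wleP/wleP => H i; move/wleP: am => /(_ i); have := H i;
  rewrite waddE ffunE; lia.
Qed.

Lemma wsub_sub a b m : wsub (wsub m a) b = wsub m (a + b).
Proof. by apply/ffunP => i; rewrite !ffunE subnDA. Qed.

Lemma wle_trans a b m : wle a b -> wle b m -> wle a m.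
Proof. by move=> /wleP ab /wleP bm; apply/wleP => i; apply: leq_trans (bm i). Qed.

Lemma shift_shift a b f : shift a (shift b f) = shift (a + b) f.
Proof.
apply: funext => m; rewrite /shift; case: ifPn => am.
  by rewrite wle_sub // wsub_sub addrC.
rewrite ifN //; apply: contra am; apply: wle_trans; rewrite addrC; exact: wle_addl.
Qed.

Lemma shift_lin a I (s : seq I) (P : pred I) (c : I -> R) (F : I -> {ffun 'I_n -> nat} -> R) m :
  shift a (fun m => \sum_(i <- s | P i) c i * F i m) m = \sum_(i <- s | P i) c i * shift a (F i) m.
Proof. by rewrite /shift; case: ifP => // _; rewrite big1 // => i; rewrite mulr0. Qed.

Definition below m : seq {ffun 'I_n -> nat} :=
  [seq a <- [seq [ffun i => (x i : nat)] | x : {ffun 'I_n -> 'I_(ht m).+1}] | wle a m].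

Lemma mem_below m a : (a \in below m) = wle a m.
Proof.
rewrite mem_filter; apply: andb_idr => /wleP am; apply/mapP.
exists [ffun i => inord (a i)]; first by rewrite mem_enum.
apply/ffunP => i; rewrite !ffunE /= inordK // ltnS.
exact: leq_trans (am i) (leq_ht _ _).
Qed.

Lemma below_uniq m : uniq (below m).
Proof.
apply: filter_uniq; rewrite map_inj_uniq ?enum_uniq // => a b /ffunP ab.
by apply/ffunP => i; apply/val_inj; have := ab i; rewrite !ffunE.
Qed.

(* Multiplication by the series with coefficients C. *)
Definition conv (C : {ffun 'I_n -> nat} -> R) f m : R :=
  \sum_(a <- below m) C a * f (wsub m a).

Lemma conv_shift C b f : conv C (shift b f) = shift b (conv C f).
Proof.
apply: funext => m; rewrite /conv {2}/shift.
transitivity (\sum_(a <- below m | wle b (wsub m a)) C a * f (wsub m (a + b))).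
  rewrite [RHS]big_mkcond; apply: eq_bigr => a _; rewrite /shift.
  by case: ifP => _; rewrite ?mulr0 // wsub_sub.
rewrite -big_filter; case: ifPn => bm; last first.
  rewrite big_seq big1 // => a; rewrite mem_filter => /andP [ba _].
  case/negP: bm; apply: wle_trans ba _; apply/wleP => i; rewrite ffunE leq_subr //.
rewrite (perm_big (below (wsub m b))); last first.
  apply: uniq_perm; [exact/filter_uniq/below_uniq|exact: below_uniq|move=> a].
  rewrite mem_filter !mem_below [LHS]andbC (wle_sub _ bm); case: (boolP (wle a m)) => [am|am].
    by rewrite /= wle_sub // addrC.
  apply/esym/negbTE; apply: contra am; apply: wle_trans; rewrite addrC; exact: wle_addl.
by apply: eq_bigr => a _; rewrite wsub_sub addrC.
Qed.

Lemma conv_lin C I (s : seq I) (P : pred I) (c : I -> R) (F : I -> {ffun 'I_n -> nat} -> R) m :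
  conv C (fun m => \sum_(i <- s | P i) c i * F i m) m = \sum_(i <- s | P i) c i * conv C (F i) m.
Proof.
rewrite /conv; under eq_bigr do rewrite mulr_sumr.
rewrite exchange_big; apply: eq_bigr => i _; rewrite mulr_sumr.
by apply: eq_bigr => a _; rewrite mulrCA.
Qed.

(** Multiplication by the polynomial with coefficient c S at x^S. *)
Definition setop (c : {set 'I_n} -> R) f m : R := \sum_S c S * shift (ind S) f m.

Lemma setopC c d f : setop c (setop d f) = setop d (setop c f).
Proof.
apply: funext => m; rewrite /setop.
under eq_bigr do rewrite shift_lin mulr_sumr.
under [RHS]eq_bigr do rewrite shift_lin mulr_sumr.
rewrite exchange_big; apply: eq_bigr => S _; apply: eq_bigr => T _.
by rewrite !shift_shift mulrCA addrC.
Qed.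

Lemma setop_conv c C f : setop c (conv C f) = conv C (setop c f).
Proof.
apply: funext => m; rewrite /setop conv_lin; apply: eq_bigr => S _.
by rewrite conv_shift.
Qed.

Definition euler f m : R := (ht m)%:R * f m.

Lemma euler_shift a f m : euler (shift a f) m = shift a (euler f) m + (ht a)%:R * shift a f m.
Proof.
rewrite /euler /shift; case: ifP => am; last by rewrite !mulr0 addr0.
by rewrite -{1}(wsubK am) htD natrD mulrDl.
Qed.

Lemma euler_setop c f m :
  euler (setop c f) m = setop c (euler f) m + setop (fun S => (#|S|)%:R * c S) f m.
Proof.
rewrite {1}/euler /setop mulr_sumr -big_split; apply: eq_bigr => S _.
transitivity (c S * euler (shift (ind S) f) m); first by rewrite mulrCA.
by rewrite euler_shift ht_ind mulrDr; congr (_ + _); rewrite mulrA [c S * _]mulrC.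
Qed.

(** * Powers of the inverse of a series *)

Section InverseSeries.
Variables (c : {set 'I_n} -> R) (C h : {ffun 'I_n -> nat} -> R).
Hypotheses (ch : setop c h = fun m => (m == 0)%:R) (eh : euler h = conv C h).

Definition setpow q : {ffun 'I_n -> nat} -> R := iter q (setop c) (fun m => (m == 0)%:R).

Let c' (S : {set 'I_n}) : R := (#|S|)%:R * c S.

Lemma setopN d f : setop d (fun m => - f m) = fun m => - setop d f m.
Proof.
apply: funext => m; rewrite /setop -sumrN; apply: eq_bigr => S _.
by rewrite /shift; case: ifP; rewrite ?oppr0 ?mulrN ?mulr0 ?oppr0.
Qed.

Lemma euler_delta : euler (fun m => (m == 0)%:R) = fun=> 0.
Proof.
by apply: funext => m; rewrite /euler; case: eqP => [->|_]; rewrite ?ht0 ?mul0r ?mulr0.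
Qed.

(** Let P be the polynomial of c and E the Euler derivation, so that c' belongs to E P. Applying E
    to P h = 1 gives (E P) h = - C; multiplying by P^(q+1) gives the claim. *)
Lemma setop_card_setpow q : setop c' (setpow q) = fun m => - conv C (setpow q.+1) m.
Proof.
elim: q => [|q IH].
  have c'h : setop c' h = fun m => - conv C (setpow 0) m.
    apply: funext => m; have := euler_setop c h m.
    rewrite ch euler_delta eh setop_conv ch => /esym/eqP.
    by rewrite addrC addr_eq0 => /eqP.
  by rewrite {1}/setpow /= -ch setopC c'h setopN setop_conv ch.
by rewrite {1}/setpow /= setopC IH setopN setop_conv.
Qed.

(* As power series, setpow q is h^-q, and euler h = C h. *)
Lemma euler_setpow q m : euler (setpow q) m = - q%:R * conv C (setpow q) m.
Proof.
elim: q m => [|q IH] m; first by rewrite euler_delta oppr0 mul0r.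
rewrite {1}/setpow /= euler_setop -/(setpow q) setop_card_setpow.
have -> : euler (setpow q) = fun m => - (q%:R * conv C (setpow q) m).
  by apply: funext => m'; rewrite IH mulNr.
rewrite setopN.
have -> : setop c (fun m => q%:R * conv C (setpow q) m) m = q%:R * conv C (setpow q.+1) m.
  rewrite -[setpow q.+1]/(setop c (setpow q)) -setop_conv mulr_sumr; apply: eq_bigr => S _.
  by rewrite mulrCA /shift; case: ifP; rewrite ?mulr0.
by rewrite -natr1; ring.
Qed.
End InverseSeries.

(** * Products of one-variable series over a finite index set *)

Section MultisetSeries.
Variables (B : finType) (wt : B -> {ffun 'I_n -> nat}) (N : nat) (gam : B -> nat -> R)
  (g : B -> nat -> R).
Hypotheses (wt_gt0 : forall b, (0 < ht (wt b))%N)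
  (gE : forall b d, d%:R * g b d = \sum_(1 <= l < d.+1) gam b l * g b (d - l)%N).

(** The product over b of the series with coefficients g b d at x^(d wt b). The hypothesis [gE] says
    that gam is the logarithmic derivative of each factor. It covers both the geometric series of
    the monomials and the exponential series of the bonds. *)
Definition mset_series m : R :=
  \sum_(A : {ffun B -> 'I_N} | \sum_b wt b *+ A b == m) \prod_b g b (A b).

(** Lowering the exponent at b by l is a bijection of exponent vectors. As wt b has positive height
    and ht m < N, the bound N on exponents loses nothing. *)
Lemma mset_series_add b l m : (0 < l)%N -> (ht m < N)%N ->
  \sum_(A : {ffun B -> 'I_N} | (\sum_b wt b *+ A b == m) && (l <= A b)%N)
    g b (A b - l)%N * \prod_(b' | b' != b) g b' (A b') = shift (wt b *+ l) mset_series m.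
Proof.
move=> l0 mN.
have wtE (A : {ffun B -> 'I_N}) : \sum_b wt b *+ A b =
  wt b *+ A b + \sum_(b' | b' != b) wt b' *+ A b'.
  by rewrite (bigD1 b).
rewrite /shift; case: ifPn => [lm|lm]; last first.
  rewrite big1 // => A /andP [/eqP Am lA]; case/negP: lm; rewrite -Am wtE.
  by rewrite -(subnK lA) mulrnDr addrAC; apply: wle_addl.
(* When the new exponent is out of range, [insubd] keeps the old one; then h' (h A) = A fails
   because l > 0, so such A drop out after reindexing. *)
pose h (A : {ffun B -> 'I_N}) := [ffun b' => if b' == b then insubd (A b) (A b + l)%N else A b'].
pose h' (A : {ffun B -> 'I_N}) := [ffun b' => if b' == b then insubd (A b) (A b - l)%N else A b'].
have htA (A : {ffun B -> 'I_N}) m' : \sum_b wt b *+ A b == m' -> (A b <= ht m')%N.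
  move=> /eqP <-; rewrite wtE htD htM; apply: leq_trans (leq_addr _ _).
  by rewrite leq_pmull.
have hh' : {in [pred A : {ffun B -> 'I_N} | (\sum_b wt b *+ A b == m) && (l <= A b)%N],
  cancel h' h}.
  move=> A /andP [/htA Am lA]; apply/ffunP => b'; rewrite !ffunE eqxx.
  case: eqP => // ->; apply/val_inj; rewrite /= !val_insubd.
  by rewrite (leq_ltn_trans (leq_subr _ _)) ?ltn_ord // subnK // ltn_ord.
rewrite (reindex_onto h h') /=; last by move=> A; apply: hh'.
have hE (A : {ffun B -> 'I_N}) : \sum_(b' | b' != b) wt b' *+ h A b' =
  \sum_(b' | b' != b) wt b' *+ A b'.
  by apply: eq_bigr => b' /negbTE bb'; rewrite ffunE bb'.
have hb (A : {ffun B -> 'I_N}) : (A b + l < N)%N -> h A b = (A b + l)%N :> nat.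
  by move=> AN; rewrite ffunE eqxx val_insubd AN.
have small (A : {ffun B -> 'I_N}) : (A b + l < N)%N ->
   (\sum_b wt b *+ h A b == m) = (\sum_b wt b *+ A b == wsub m (wt b *+ l)).
  move=> AN; rewrite !wtE hE hb // mulrnDr addrAC -{1}(wsubK lm).
  by apply/eqP/eqP => [E|->//]; apply: (@waddI _ (wt b *+ l)); rewrite addrC E addrC.
apply: eq_big => [A|A /andP [/andP [hm lh] /eqP hA]].
  have [AN|NA] := ltnP (A b + l) N.
    rewrite small // hb // leq_addl andbT; apply: andb_idr => _; apply/eqP/ffunP => b'.
    rewrite !ffunE eqxx; case: eqP => // ->; apply/val_inj.
    by rewrite /= !val_insubd AN addnK ltn_ord.
  rewrite [RHS]negbTE; last first.
    apply/negP => /htA; rewrite leqNgt => /negP; apply.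
    rewrite -(ltn_add2r l); apply: leq_trans NA.
    apply: leq_ltn_trans mN; rewrite -{2}(wsubK lm) htD htM leq_add2l leq_pmull //.
  apply/negbTE/negP => /andP [/andP [_ +]] /eqP/ffunP/(_ b)/(congr1 val).
  rewrite !ffunE eqxx /= !val_insubd ltnNge NA /= => lA.
  rewrite (leq_ltn_trans (leq_subr _ _)) ?ltn_ord //; lia.
have [AN|NA] := ltnP (A b + l) N.
  rewrite [RHS](bigD1 b) //= hb // addnK; congr (_ * _).
  by apply: eq_bigr => b' /negbTE bb'; rewrite ffunE bb'.
exfalso; move: lh hA => + /ffunP/(_ b)/(congr1 val).
rewrite !ffunE eqxx /= !val_insubd ltnNge NA /= => lA.
rewrite (leq_ltn_trans (leq_subr _ _)) ?ltn_ord //; lia.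
Qed.

(** The logarithmic derivative of a product: ht m is the sum of A b times ht (wt b), and [gE]
    rewrites each A b times g b (A b). *)
Lemma mset_series_rec m : (ht m < N)%N ->
  (ht m)%:R * mset_series m =
  \sum_b \sum_(1 <= l < N) (ht (wt b))%:R * gam b l * shift (wt b *+ l) mset_series m.
Proof.
move=> mN; rewrite /mset_series mulr_sumr.
transitivity (\sum_b \sum_(A : {ffun B -> 'I_N} | \sum_b wt b *+ A b == m)
    (ht (wt b))%:R * (A b)%:R * \prod_b g b (A b)).
  rewrite exchange_big; apply: eq_bigr => A /eqP Am.
  rewrite -mulr_suml -Am ht_sum natr_sum; congr (_ * _); apply: eq_bigr => b _.
  by rewrite htM natrM.
apply: eq_bigr => b _.
transitivity (\sum_(A : {ffun B -> 'I_N} | \sum_b wt b *+ A b == m)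
    \sum_(1 <= l < N | (l <= A b)%N)
      (ht (wt b))%:R * gam b l * (g b (A b - l)%N * \prod_(b' | b' != b) g b' (A b'))).
  apply: eq_bigr => A _; rewrite (bigD1 b) //= -mulrA [X in _ * X]mulrA gE.
  rewrite mulr_suml mulr_sumr [LHS](big_nat_widen _ _ N) ?ltn_ord //=.
  by apply: eq_bigr => l _; rewrite !mulrA.
rewrite (exchange_big_dep predT) //= big_nat [RHS]big_nat; apply: eq_bigr => l /andP [l0 _].
by rewrite -mulr_sumr (mset_series_add _ l0 mN).
Qed.

Lemma mset_series0 : (0 < N)%N -> (forall b, g b 0%N = 1) -> mset_series 0 = 1.
Proof.
move=> N0 g0; rewrite /mset_series (big_pred1 [ffun=> Ordinal N0]) => [|A].
  by rewrite big1 // => b _; rewrite ffunE.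
rewrite -ht_eq0 ht_sum sum_nat_eq0; apply/forallP/eqP => [H|-> b].
  apply/ffunP => b; apply/val_inj; rewrite ffunE /=.
  by have := H b; rewrite htM muln_eq0 eqn0Ngt wt_gt0 => /eqP.
by rewrite ffunE htM muln0.
Qed.
End MultisetSeries.
End WeightSeries.

Lemma uniq_flatten_disjoint (S T : eqType) (f : S -> seq T) (k : T -> S) (s : seq S) :
  uniq s -> (forall a, uniq (f a)) -> (forall a t, t \in f a -> k t = a) ->
  uniq (flatten [seq f a | a <- s]).
Proof.
move=> us uf fk; elim: s us => //= a s IH /andP [sa us].
rewrite cat_uniq uf IH // andbT; apply/hasPn => t /flatten_mapP [a' a's ta'].
by apply: contra sa => /fk <-; rewrite (fk _ _ ta').
Qed.

(** * The logarithmic derivative of h from the dimensions of the grades *)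

Section LieSeries.
Variables (K : numFieldType) (n : nat) (e : rel 'I_n).
Hypotheses (e_sym : symmetric e) (e_irr : irreflexive e).

Implicit Types (a m : {ffun 'I_n -> nat}).
Local Notation pc := (pc_elt K e).

Definition chr_coef (a : {ffun 'I_n -> nat}) : rat := (ht a)%:R * chrmult K e a.

Definition wdiv (a : {ffun 'I_n -> nat}) l : {ffun 'I_n -> nat} := [ffun i => a i %/ l]%N.

Lemma ht_wdiv a l : [forall i, l %| a i]%N -> (ht (wdiv a l) * l)%N = ht a.
Proof.
move=> /forallP la; rewrite -htM; congr ht; apply/ffunP => i.
by rewrite wmulE ffunE divnK.
Qed.

(** The denominator l cancels because ht a = l ht (a / l). Terms with l > ht a occur only for a = 0
    and vanish, so one bound N serves all weights and allows the sums to be exchanged. *)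
Lemma chr_coefE a N : (ht a < N)%N ->
  chr_coef a = \sum_(1 <= l < N | [forall i, l %| a i]%N)
    (ht (wdiv a l))%:R * (mult K e (wdiv a l))%:R.
Proof.
move=> aN; rewrite /chr_coef /chrmult mulr_sumr (big_nat_widen _ _ N) //.
rewrite big_mkcond [RHS]big_mkcond big_nat [RHS]big_nat; apply: eq_bigr => l /andP [l0 _].
case: ifP => [/andP [la _]|]; last first.
  case: ifP => // la /=; rewrite ltnNge => /negbFE al.
  rewrite (_ : ht _ = 0%N) ?mul0r //; apply/eqP; rewrite ht_eq0; apply/eqP/ffunP => i.
  by rewrite w0E ffunE divn_small //; apply: leq_ltn_trans (leq_ht _ _) al.
rewrite la -(ht_wdiv la) natrM -mulrA; congr (_ * _).
by rewrite mulrCA mulfV ?mulr1 // pnatr_eq0 -lt0n.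
Qed.

(** In heights at most ht m, h is a product of geometric series, one for each basis element. The
    coefficient at a of its logarithmic derivative collects the pairs of a basis element and a
    multiplier l with l times its weight equal to a. *)
Lemma traces_rec m : (ht m)%:R * (size (traces e m))%:R =
  conv chr_coef (fun m => (size (traces e m))%:R) m :> rat.
Proof.
set h := fun m => (size (traces e m))%:R : rat.
have [tb tbP] := choice (tree_basis_exists K e).
pose N := (ht m).+1.
pose wl := [seq a <- below ([ffun=> N] : {ffun 'I_n -> nat}) | (ht a < N)%N].
have mem_wl a : (a \in wl) = (ht a < N)%N.
  rewrite mem_filter mem_below; apply: andb_idr => aN; apply/wleP => i.
  by rewrite ffunE; apply: leq_trans (leq_ht a i) (ltnW aN).
have wl_uniq : uniq wl by apply/filter_uniq/below_uniq.
pose BT := flatten [seq tb a | a <- wl].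
pose bt (i : 'I_(size BT)) := tnth (in_tuple BT) i.
have tb_wt a t : t \in tb a -> magma_wt t = a by case: (tbP a) => _ + _ _; apply.
have BT_uniq : uniq BT.
  apply: (uniq_flatten_disjoint (k := @magma_wt n)) => // a.
  by case: (tbP a) => [[]].
have sumBT (V : nmodType) (P : pred (magma 'I_n)) (F : magma 'I_n -> V) :
    \sum_(b | P (bt b)) F (bt b) = \sum_(a <- wl) \sum_(t <- tb a | P t) F t.
  by rewrite -big_tnth /BT big_flatten big_map.
have sumBTw (V : nmodType) a (F : magma 'I_n -> V) : (ht a < N)%N ->
    \sum_(b | magma_wt (bt b) == a) F (bt b) = \sum_(t <- tb a) F t.
  move=> aN; rewrite (sumBT _ (fun t => magma_wt t == a)) (bigD1_seq a) ?mem_wl //=.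
  rewrite [X in _ + X]big1 ?addr0 => [|a' a'a].
    by rewrite big_seq_cond [RHS]big_seq; apply: eq_bigl => t; apply: andb_idr => /tb_wt ->.
  by rewrite big_seq_cond big1 // => t /andP [/tb_wt ->]; rewrite (negbTE a'a).
have bt_mem b : exists2 a, (ht a < N)%N & bt b \in tb a.
  by have /flatten_mapP [a] := mem_tnth b (in_tuple BT); rewrite mem_wl; exists a.
have bt_lt b : (ht (magma_wt (bt b)) < N)%N by have [a aN /tb_wt ->] := bt_mem b.
have bt_span t : (ht (magma_wt t) < N)%N ->
    exists c : 'I_(size BT) -> K, pc t = \sum_(b | magma_wt (bt b) == magma_wt t) c b *: pc (bt b).
  move=> tN; have [_ _ _ /(_ t erefl) [c ->]] := tbP (magma_wt t).
  by exists (fun b => c (bt b)); rewrite (sumBTw _ _ (fun t => c t *: pc t)).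
have bt_free a (c : 'I_(size BT) -> K) :
    \sum_(b | magma_wt (bt b) == a) c b *: pc (bt b) = 0 -> forall b,
      magma_wt (bt b) = a -> c b = 0.
  move=> E b ba; have [a' a'N ba'] := bt_mem b.
  have aa' : a' = a by rewrite -ba (tb_wt _ _ ba').
  pose c' t := if insub (index t BT) is Some i then c i else 0.
  have c'E i : c' (bt i) = c i.
    rewrite /c' /bt (tnth_nth (bt i)) index_uniq ?ltn_ord // valK //.
  have [_ _ fr _] := tbP a; rewrite -c'E; apply: fr; last by rewrite -aa'.
  rewrite -(sumBTw _ a (fun t => c' t *: pc t)); last by rewrite -aa'.
  by rewrite -[RHS]E; apply: eq_bigr => i _; rewrite c'E.
pose Z := mset_series (fun b => magma_wt (bt b)) N (fun _ _ => 1 : rat).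
(* The recursion refers to lower weights, so the product formula is needed at every height below N
   and not only at m. *)
have hZ m' : (ht m' < N)%N -> h m' = Z m'.
  move=> m'N; rewrite /h (card_traces e_sym bt_lt bt_span bt_free m'N).
  rewrite /Z /mset_series -sum1_card natr_sum.
  by apply: eq_big => [A|A _]; rewrite ?inE // big1.
rewrite -[_%:R in X in _ * X]/(h m) hZ // /Z.
rewrite (@mset_series_rec _ _ _ _ _ (fun _ _ => 1)) //; last 2 first.
- by move=> b; apply: ht_magma_gt0.
- move=> b d; rewrite mulr1 (eq_bigr (fun=> 1)); last by move=> l _; rewrite mulr1.
  by rewrite big_const_nat subSS subn0 iter_addr_0.
pose F a := \sum_(1 <= l < N) (ht a)%:R * shift (a *+ l) h m.
transitivity (\sum_(b : 'I_(size BT)) F (magma_wt (bt b))).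
  apply: eq_bigr => b _; apply: eq_bigr => l _; rewrite mulr1; congr (_ * _).
  rewrite /shift; case: ifP => // lm; rewrite -/Z hZ // ltnS.
  by apply: wle_ht; apply/wleP => i; rewrite ffunE leq_subr.
rewrite (sumBT _ predT (fun t => F (magma_wt t))).
transitivity (\sum_(a <- wl) (mult K e a)%:R * F a).
  apply: eq_bigr => a _; have [[_ <-] _ _ _] := tbP a.
  rewrite mulr_natl -iter_addr_0 -(count_predT (tb a)) -big_const_seq.
  rewrite big_seq_cond [RHS]big_seq_cond; apply: eq_bigr => t.
  by rewrite andbT => /tb_wt ->.
pose G a : rat := (ht a)%:R * (mult K e a)%:R.
transitivity (\sum_(1 <= l < N) \sum_(a <- wl) G a * shift (a *+ l) h m).
  rewrite exchange_big; apply: eq_bigr => a _; rewrite mulr_sumr; apply: eq_bigr => l _.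
  by rewrite mulrA [_%:R * _]mulrC.
(* The multiple l a becomes the new summation variable. *)
transitivity (\sum_(1 <= l < N) \sum_(a <- below m | [forall i,
  l %| a i]%N) G (wdiv a l) * h (wsub m a)).
  rewrite big_nat [RHS]big_nat; apply: eq_bigr => l /andP [l0 _].
  rewrite -[RHS]big_filter [RHS](perm_big [seq a *+ l | a <- wl & wle (a *+ l) m]); last first.
    have mulI : injective (fun a : {ffun 'I_n -> nat} => a *+ l).
      move=> a a' /ffunP E; apply/ffunP => i; have := E i; rewrite !wmulE => /eqP.
      by rewrite eqn_pmul2r // => /eqP.
    apply: uniq_perm; [exact/filter_uniq/below_uniq|by rewrite (map_inj_uniq mulI);
      apply: filter_uniq|].
    move=> a; rewrite mem_filter mem_below; apply/andP/mapP => [[la am]|[a' + ->]].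
      have aE : a = wdiv a l *+ l.
        by apply/ffunP => i; rewrite wmulE ffunE divnK // (forallP la).
      exists (wdiv a l) => //; rewrite mem_filter -aE am mem_wl ltnS.
      apply: leq_trans (wle_ht am); rewrite -(ht_wdiv la) leq_pmulr //.
    rewrite mem_filter => /andP [am _]; split=> //.
    by apply/forallP => i; rewrite wmulE dvdn_mull.
  rewrite big_map big_filter [RHS]big_mkcond; apply: eq_bigr => a _.
  rewrite /shift; case: ifP => _; last by rewrite mulr0.
  by congr (G _ * _); apply/ffunP => i; rewrite ffunE wmulE mulnK.
rewrite (exchange_big_dep predT) //= /conv big_seq [RHS]big_seq; apply: eq_bigr => a.
rewrite mem_below => /wle_ht am; rewrite -mulr_suml (@chr_coefE a N) ?ltnS //.
Qed.

(** * Vanishing in degrees of disconnected support *)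

Definition wconn a := [forall i, forall j, (0 < a i)%N && (0 < a j)%N ==>
  connect [rel x y | [&& 0 < a x, 0 < a y & e x y]%N] i j].

Lemma wconnP a : reflect (forall i j, (0 < a i)%N -> (0 < a j)%N ->
  connect [rel x y | [&& 0 < a x, 0 < a y & e x y]%N] i j) (wconn a).
Proof.
apply: (iffP forallP) => [H i j ai aj|H i].
  by move/forallP: (H i) => /(_ j); rewrite ai aj.
by apply/forallP => j; apply/implyP => /andP [ai aj]; apply: H.
Qed.

(** If a bracket is nonzero, so are both factors, whose supports are connected by induction; and
    some edge joins these supports, since otherwise the factors would commute. *)
Lemma pc_elt_conn t : pc t <> 0 -> wconn (magma_wt t).
Proof.
rewrite pc_eltE; elim: t => [i _|l IHl r IHr lr].
  apply/wconnP => x y; rewrite !ffunE; case: eqP => // <- _; case: eqP => // <- _.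
  exact: connect0.
have /IHl/wconnP cl : lie_eval (fun i => pc (Leaf i)) l <> 0.
  by move=> l0; apply: lr; rewrite /= l0 bracket0l.
have /IHr/wconnP cr : lie_eval (fun i => pc (Leaf i)) r <> 0.
  by move=> r0; apply: lr; rewrite /= r0 bracket0r.
have [i [j [li rj ij]]] : exists i j, [/\ (0 < magma_wt l i)%N, (0 < magma_wt r j)%N & e i j].
  apply: contra_notP lr => H; apply: (bracket_disconnected (@pc_elt_comm K n e)) => i j li rj.
  by apply/negP => ij; apply: H; exists i, j.
rewrite magma_wt_node; set a := _ + _.
have al x : (0 < magma_wt l x)%N -> (0 < a x)%N by rewrite waddE addn_gt0 => ->.
have ar x : (0 < magma_wt r x)%N -> (0 < a x)%N by rewrite waddE addn_gt0 orbC => ->.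
set ea := [rel x y | [&& 0 < a x, 0 < a y & e x y]%N].
have cal x y : (0 < magma_wt l x)%N -> (0 < magma_wt l y)%N -> connect ea x y.
  move=> lx ly; apply: (connect_sub _ (cl x y lx ly)) => u v /and3P [/al lu /al lv uv].
  by apply: connect1; rewrite /= lu lv.
have car x y : (0 < magma_wt r x)%N -> (0 < magma_wt r y)%N -> connect ea x y.
  move=> lx ly; apply: (connect_sub _ (cr x y lx ly)) => u v /and3P [/ar lu /ar lv uv].
  by apply: connect1; rewrite /= lu lv.
have cij : connect ea i j by apply: connect1; rewrite /= al // ar.
have cji : connect ea j i by apply: connect1; rewrite /= (al _ li) (ar _ rj) e_sym.
apply/wconnP => x y; rewrite !waddE !addn_gt0 => /orP [lx|rx] /orP [ly|ry].
- exact: cal.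
- exact: connect_trans (cal _ _ lx li) (connect_trans cij (car _ _ rj ry)).
- exact: connect_trans (car _ _ rx rj) (connect_trans cji (cal _ _ li ly)).
- exact: car.
Qed.

Lemma mult_disconnected a : ~~ wconn a -> mult K e a = 0%N.
Proof.
move=> ca; have [[|t s] [[_ <-] //= wt fr _]] := tree_basis_exists K e a.
case/negP: ca; rewrite -(wt t) ?mem_head //; apply: pc_elt_conn => t0.
have : 1 = 0 :> K.
  have := fr (fun x => if x == t then 1 else 0) _ t (mem_head _ _); rewrite eqxx; apply.
  by apply: big1 => x _; case: eqP => [->|_]; [rewrite t0; apply: scaler0|apply: scale0r].
by move/eqP; rewrite oner_eq0.
Qed.

(** Dividing by l does not change the support, so every term of the sum vanishes. *)
Lemma chr_coef_disconnected a : ~~ wconn a -> chr_coef a = 0.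
Proof.
move=> ca; rewrite (@chr_coefE a (ht a).+1) // big_nat_cond big1 // => l /andP [/andP [l0 _] la].
rewrite mult_disconnected ?mulr0 //; apply: contra ca.
have E i : (0 < wdiv a l i)%N = (0 < a i)%N.
  rewrite ffunE divn_gt0 //; move/forallP: la => /(_ i).
  by case: (a i) => [_|d /dvdn_leq -> //]; rewrite leqNgt l0.
move=> /wconnP H; apply/wconnP => i j; rewrite -!E => ai aj.
by apply: (connect_sub _ (H i j ai aj)) => x y; rewrite /= !E => xy; apply: connect1.
Qed.

End LieSeries.

(** * Multicolorings and bonds *)

Section Multicolorings.
Variables (n : nat) (e : rel 'I_n).
Implicit Types (m : {ffun 'I_n -> nat}) (S : {set 'I_n}).

(** S becomes the class of the additional last color; each coloring with q + 1 colors arises once in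
    this way. *)
Definition add_color q S (c : {ffun 'I_n -> {set 'I_q}}) : {ffun 'I_n -> {set 'I_q.+1}} :=
  [ffun i => [set x | if unlift ord_max x is Some y then y \in c i else i \in S]].

Lemma mem_add_color_max q S (c : {ffun 'I_n -> {set 'I_q}}) i :
  (ord_max \in add_color S c i) = (i \in S).
Proof. by rewrite ffunE inE unlift_none. Qed.

Lemma mem_add_color_lift q S (c : {ffun 'I_n -> {set 'I_q}}) i x :
  (lift ord_max x \in add_color S c i) = (x \in c i).
Proof. by rewrite ffunE inE liftK. Qed.

Lemma card_add_color q S (c : {ffun 'I_n -> {set 'I_q}}) i :
  #|add_color S c i| = (#|c i| + (i \in S))%N.
Proof.
rewrite -sum1_card big_mkcond big_ord_recr /= mem_add_color_max -[#|c i|]sum1_card.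
rewrite [in RHS]big_mkcond /=; congr (_ + _)%N.
apply: eq_bigr => x _; rewrite (_ : widen_ord _ x = lift ord_max x) ?mem_add_color_lift //.
exact/val_inj/esym/lift_max.
Qed.

Lemma disjoint_add_color q S (c : {ffun 'I_n -> {set 'I_q}}) i j :
  [disjoint add_color S c i & add_color S c j] =
  [disjoint c i & c j] && ~~ ((i \in S) && (j \in S)).
Proof.
apply/idP/andP => [d|[d ij]].
  split.
    apply/pred0P => x /=; have /pred0P/(_ (lift ord_max x)) := d.
    by rewrite /= !mem_add_color_lift.
  by have /pred0P/(_ ord_max) := d; rewrite /= !mem_add_color_max => ->.
apply/pred0P => x /=; case: (unliftP ord_max x) => [y|] ->.
  by rewrite !mem_add_color_lift; have /pred0P/(_ y) := d.
by rewrite !mem_add_color_max (negbTE ij).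
Qed.

Lemma multicoloring_add_color q S (c : {ffun 'I_n -> {set 'I_q}}) m :
  (add_color S c \in multicoloring e m q.+1) =
  [&& indep e S, wle (ind S) m & c \in multicoloring e (wsub m (ind S)) q].
Proof.
rewrite !inE; apply/andP/and3P => [[/forallP ck /forallP cd]|[/indepP Si /wleP Sm]].
  have Sm : wle (ind S) m.
    by apply/wleP => i; rewrite -(eqP (ck i)) card_add_color ffunE leq_addl.
  split=> //.
    apply/indepP => i j iS jS; apply/negP => ij.
    by have /forallP/(_ j) := cd i; rewrite ij disjoint_add_color iS jS andbF.
  apply/andP; split.
    by apply/forallP => i; rewrite !ffunE -(eqP (ck i)) card_add_color addnK.
  apply/forallP => i; apply/forallP => j; apply/implyP => ij.
  by have /forallP/(_ j) := cd i; rewrite ij disjoint_add_color => /andP [].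
move=> /andP [/forallP ck /forallP cd]; split.
  apply/forallP => i; rewrite card_add_color (eqP (ck i)) ffunE.
  by have := Sm i; rewrite !ffunE => iS; rewrite subnK.
apply/forallP => i; apply/forallP => j; apply/implyP => ij.
rewrite disjoint_add_color (implyP (forallP (cd i) j) ij) /=.
by apply/negP => /andP [iS jS]; have := Si i j iS jS; rewrite ij.
Qed.

Lemma card_multicoloring_rec m q : #|multicoloring e m q.+1| =
  (\sum_(S | indep e S && wle (ind S) m) #|multicoloring e (wsub m (ind S)) q|)%N.
Proof.
pose f (p : {set 'I_n} * {ffun 'I_n -> {set 'I_q}}) := add_color p.1 p.2.
pose f' (c : {ffun 'I_n -> {set 'I_q.+1}}) : {set 'I_n} * {ffun 'I_n -> {set 'I_q}} :=
  ([set i | ord_max \in c i], [ffun i => [set x | lift ord_max x \in c i]]).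
have fK : cancel f f'.
  move=> [S c]; congr (_, _); first by apply/setP => i; rewrite inE mem_add_color_max.
  by apply/ffunP => i; apply/setP => x; rewrite ffunE inE mem_add_color_lift.
have f'K : cancel f' f.
  move=> c; apply/ffunP => i; apply/setP => x; case: (unliftP ord_max x) => [y|] ->.
    by rewrite mem_add_color_lift ffunE inE.
  by rewrite mem_add_color_max inE.
rewrite -sum1_card (reindex f) /=; last by exists f' => ? _; rewrite ?fK ?f'K.
under eq_bigl do rewrite multicoloring_add_color.
rewrite big_mkcond [RHS]big_mkcond.
rewrite -(pair_bigA _ (fun S (c : {ffun 'I_n -> {set 'I_q}}) => if [&& indep e S, wle (ind S) m
  & c \in multicoloring e (wsub m (ind S)) q] then 1%N else 0%N)) /=.
apply: eq_bigr => S _; case: (indep e S); case: (wle (ind S) m) => /=; try by rewrite big1.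
by rewrite -sum1_card [RHS]big_mkcond.
Qed.

Lemma card_multicoloring0 m : #|multicoloring e m 0| = (m == 0).
Proof.
have c0 (c : {ffun 'I_n -> {set 'I_0}}) : (c \in multicoloring e m 0) = (m == 0).
  have cE i : c i = set0 by apply/setP => -[].
  rewrite inE; apply/andP/eqP => [[/forallP ck _]|->].
    by apply/ffunP => i; rewrite w0E -(eqP (ck i)) cE cards0.
  split; first by apply/forallP => i; rewrite cE cards0 w0E.
  apply/forallP => i; apply/forallP => j; apply/implyP => _.
  by rewrite cE -setI_eq0 set0I.
rewrite -sum1_card (eq_bigl _ _ c0); case: eqP => _; last by rewrite big_pred0.
rewrite (big_pred1 [ffun=> set0]) // => c; apply/esym/eqP/ffunP => i; rewrite ffunE.
by apply/setP => -[].
Qed.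

Definition signed_indep S : rat := (indep e S)%:R * (-1) ^+ #|S|.

Lemma multicoloring_setpow q m :
  (-1) ^+ ht m * #|multicoloring e m q|%:R = setpow signed_indep q m.
Proof.
elim: q m => [|q IH] m.
  by rewrite card_multicoloring0 /=; case: eqP => [->|_]; rewrite ?ht0 ?mul1r ?mulr0.
rewrite card_multicoloring_rec natr_sum mulr_sumr big_mkcond.
rewrite -[RHS]/(setop signed_indep (setpow signed_indep q) m); apply: eq_bigr => S _.
rewrite /shift -/(setpow signed_indep q) -IH /signed_indep; case: (indep e S);
  last by rewrite !mul0r.
rewrite mul1r /=; case: ifP => Sm; last by rewrite mulr0.
by rewrite mulrA -exprD -{1}(wsubK Sm) htD ht_ind addnC.
Qed.

End Multicolorings.

(** * The exponential formula for bonds *)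

Section BondSeries.
Variables (K : numFieldType) (n : nat) (e : rel 'I_n).
Hypotheses (e_sym : symmetric e).
Implicit Types (a m : {ffun 'I_n -> nat}) (P : {mset 'I_n}) (J : {mset {mset 'I_n}}).

(** The inverse of [part_wt]: a part is the same thing as its weight, so a bond is a multiset of
    nonzero weights of connected support. *)
Definition mset_of_wt a : {mset 'I_n} := seq_mset (flatten [seq nseq (a i) i | i <- enum 'I_n]).

Lemma mset_of_wtE a i : mset_of_wt a i = a i.
Proof.
rewrite mset_seqE count_flatten -map_comp sumnE big_map big_enum (bigD1 i) //=.
by rewrite count_nseq /= eqxx mul1n big1 ?addn0 // => j /negbTE ij; rewrite count_nseq /= ij.
Qed.

Lemma mset_of_wtK : cancel mset_of_wt (@part_wt n).
Proof. by move=> a; apply/ffunP => i; rewrite ffunE mset_of_wtE. Qed.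

Lemma part_wtK : cancel (@part_wt n) mset_of_wt.
Proof. by move=> P; apply/msetP => i; rewrite mset_of_wtE ffunE. Qed.

Lemma part_wt0 P : (part_wt P == 0) = (P == mset0).
Proof.
apply/eqP/eqP => [P0|->]; last by apply/ffunP => i; rewrite !ffunE mset0E.
by apply/msetP => i; rewrite mset0E -(ffunE (fun i => P i)) -/(part_wt P) P0 w0E.
Qed.

Lemma connected_partE P : connected_part e P = (part_wt P != 0) && wconn e (part_wt P).
Proof.
rewrite /connected_part part_wt0; congr (_ && _).
apply: eq_forallb => i; apply: eq_forallb => j; rewrite !in_mset !ffunE; congr (_ ==> _).
by apply: eq_connect => x y /=; rewrite !in_mset !ffunE.
Qed.

Lemma bond_lattice_wt m J : bond_lattice e m J -> \sum_(P <- J) part_wt P = m.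
Proof.
move=> [_ Jm]; apply/ffunP => i; rewrite sum_ffunE -Jm.
by apply: eq_bigr => P _; rewrite ffunE.
Qed.

Lemma bond_lattice_size m J : bond_lattice e m J -> (size J <= ht m)%N.
Proof.
move=> Jm; rewrite -(bond_lattice_wt Jm) ht_sum -sum1_size big_seq [leqRHS]big_seq.
apply: leq_sum => P PJ; have [/(_ P PJ) + _] := Jm.
by rewrite connected_partE -ht_eq0 -lt0n => /andP [].
Qed.

Lemma bond_lattice_part m J P : bond_lattice e m J -> P \in J -> (ht (part_wt P) <= ht m)%N.
Proof.
move=> Jm PJ; rewrite -(bond_lattice_wt Jm) ht_sum (big_rem P) //=.
exact: leq_addr.
Qed.

Definition bond_sum (x : rat) m : rat :=
  \sum_(J \in bond_lattice e m) chrmult_bond e K J * x ^+ size (J : {mset {mset 'I_n}}).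

Section Bounded.
Variables (x : rat) (N : nat).

Definition part_wts := [seq a <- below ([ffun=> N] : {ffun 'I_n -> nat}) |
  (ht a < N)%N && connected_part e (mset_of_wt a)].
Definition parts := [seq mset_of_wt a | a <- part_wts].

Lemma mem_part_wts a : (a \in part_wts) = (ht a < N)%N && connected_part e (mset_of_wt a).
Proof.
rewrite mem_filter mem_below; apply: andb_idr => /andP [aN _]; apply/wleP => i.
by rewrite ffunE; apply: leq_trans (leq_ht a i) (ltnW aN).
Qed.

Lemma mem_parts P : (P \in parts) = (ht (part_wt P) < N)%N && connected_part e P.
Proof.
by rewrite -{1}(part_wtK P) (mem_map (can_inj mset_of_wtK)) mem_part_wts part_wtK.
Qed.

Lemma parts_uniq : uniq parts.
Proof. by rewrite (map_inj_uniq (can_inj mset_of_wtK)); apply/filter_uniq/below_uniq. Qed.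

Local Notation B := 'I_(size parts).
Definition part (b : B) : {mset 'I_n} := tnth (in_tuple parts) b.

Lemma part_inj : injective part.
Proof.
move=> b b'; rewrite /part !(tnth_nth mset0) => /eqP.
by rewrite nth_uniq ?parts_uniq ?ltn_ord // => /eqP/val_inj.
Qed.

Lemma part_mem b : part b \in parts. Proof. exact: mem_tnth. Qed.

Lemma partP P : P \in parts -> exists b, P = part b.
Proof.
move=> PP; have iP : (index P parts < size parts)%N by rewrite index_mem.
by exists (Ordinal iP); rewrite /part (tnth_nth mset0) nth_index.
Qed.

Definition bond_of (A : {ffun B -> 'I_N}) : {mset {mset 'I_n}} :=
  seq_mset (flatten [seq nseq (A b) (part b) | b <- enum B]).

Lemma bond_ofE A b : bond_of A (part b) = A b.
Proof.
rewrite mset_seqE count_flatten -map_comp sumnE big_map big_enum (bigD1 b) //=.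
rewrite count_nseq /= eqxx mul1n big1 ?addn0 // => b' bb'.
by rewrite count_nseq /= (inj_eq part_inj) (negbTE bb').
Qed.

Lemma bond_of_parts A P : P \in bond_of A -> P \in parts.
Proof.
rewrite (perm_mem (perm_eq_seq_mset _)) => /flatten_mapP [b _].
by rewrite mem_nseq => /andP [_ /eqP ->]; apply: part_mem.
Qed.

Lemma bond_of_inj : injective bond_of.
Proof.
by move=> A A' E; apply/ffunP => b; apply/val_inj; rewrite /= -!bond_ofE E.
Qed.

Lemma sum_bond_of (V : nmodType) (F : {mset 'I_n} -> V) A :
  \sum_(P <- bond_of A) F P = \sum_b F (part b) *+ A b.
Proof.
rewrite (perm_big _ (perm_eq_seq_mset _)) big_flatten big_map big_enum.
by apply: eq_bigr => b _; rewrite big_nseq iter_addr_0.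
Qed.

Lemma bond_of_lattice A m :
  bond_lattice e m (bond_of A) <-> \sum_b part_wt (part b) *+ A b = m.
Proof.
rewrite -(sum_bond_of (@part_wt n)); split=> [/bond_lattice_wt //|<-]; split=> [P /bond_of_parts|i].
  by rewrite mem_parts => /andP [].
by rewrite sum_ffunE; apply: eq_bigr => P _; rewrite ffunE.
Qed.

Lemma bond_lattice_of m J : (ht m < N)%N -> bond_lattice e m J -> exists A, J = bond_of A.
Proof.
move=> mN Jm; have JN P : (J P < N)%N.
  apply: leq_ltn_trans mN; apply: leq_trans (bond_lattice_size Jm).
  by rewrite -count_mem_mset count_size.
exists [ffun b => Ordinal (JN (part b))]; apply/msetP => P.
have [/partP [b ->]|PN] := boolP (P \in parts); first by rewrite bond_ofE ffunE.
transitivity 0%N; last first.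
  by apply/esym/mset_eq0P; apply: contra PN => /bond_of_parts.
apply/mset_eq0P; apply: contra PN => PJ; rewrite mem_parts.
rewrite (leq_ltn_trans (bond_lattice_part Jm PJ) mN) /=.
by have [/(_ P PJ)] := Jm.
Qed.

(** The coefficients of the exponential of x times [chrmult] of the part. *)
Definition part_coef b d : rat := (x * chrmult K e (part_wt (part b))) ^+ d / d`!%:R.

Definition bond_series := mset_series (fun b => part_wt (part b)) N part_coef.

Lemma bond_of_coef A :
  chrmult_bond e K (bond_of A) * x ^+ size (bond_of A) = \prod_b part_coef b (A b).
Proof.
pose G P d : rat := chrmult K e (part_wt P) ^+ d / d`!%:R.
have -> : chrmult_bond e K (bond_of A) = \prod_b G (part b) (A b).
  under [RHS]eq_bigr do rewrite -bond_ofE.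
  transitivity (\prod_(P <- parts) G P (bond_of A P)); last by rewrite big_tnth.
  (* The product over the parts that occur extends to all parts, as multiplicity 0 gives the factor
     1. *)
  rewrite (bigID (fun P => P \in bond_of A)) /= [X in _ * X]big1 ?mulr1 => [|P /mset_eq0P ->].
    rewrite -[RHS]big_filter; apply: perm_big; apply: uniq_perm;
      rewrite ?filter_uniq ?parts_uniq //.
    move=> P; rewrite mem_filter msuppE; apply/esym/andb_idr.
    exact: bond_of_parts.
  by rewrite /G expr0 fact0 divr1.
have -> : x ^+ size (bond_of A) = \prod_b x ^+ A b.
  rewrite -[size _]sum1_size (sum_bond_of (fun=> 1%N)).
  rewrite (big_morph _ (exprD x) (expr0 x)); apply: eq_bigr => b _.
  by rewrite -mulr_natl mulr1 natn.
rewrite -big_split; apply: eq_bigr => b _.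
by rewrite /G /part_coef exprMn /= mulrC mulrA.
Qed.

Lemma bond_sumE m : (ht m < N)%N -> bond_sum x m = bond_series m.
Proof.
move=> mN; pose r := [seq bond_of A | A <- enum [pred A : {ffun B ->
  'I_N} | \sum_b part_wt (part b) *+ A b == m]].
have rE : bond_lattice e m = [set` r]%classic.
  apply/seteqP; split=> J /=.
    move=> Jm; have [A AE] := bond_lattice_of mN Jm.
    rewrite AE; apply: map_f; rewrite mem_enum inE; apply/eqP.
    by apply/bond_of_lattice; rewrite -AE.
  by move=> /mapP [A]; rewrite mem_enum inE => /eqP Am ->; apply/bond_of_lattice.
rewrite /bond_sum rE -fsbig_seq; last by rewrite (map_inj_uniq bond_of_inj) enum_uniq.
by rewrite big_map big_enum; apply: eq_bigr => A _; apply: bond_of_coef.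
Qed.

End Bounded.

Lemma bond_sum0 x : bond_sum x 0 = 1.
Proof.
rewrite (@bond_sumE x 1) ?ht0 //; apply: mset_series0 => // b;
  rewrite ?/part_coef ?expr0 ?fact0 ?divr1 //.
have := part_mem b; rewrite mem_parts connected_partE -ht_eq0 -lt0n => /andP [_ /andP []] //.
Qed.

(** An exponential has a logarithmic derivative concentrated at l = 1, where it equals x times
    [chrmult]. *)
Lemma bond_sum_rec x m : (ht m)%:R * bond_sum x m = x * conv (chr_coef K e) (bond_sum x) m.
Proof.
(* One more than the bound [mN] requires, so that l = 1 lies in the range 1 <= l < N even for m =
   0. *)
pose N := (ht m).+2; have mN : (ht m < N)%N by rewrite ltnW.
rewrite (bond_sumE _ mN) (mset_series_rec (gam := fun b l => if l == 1%N then
   x * chrmult K e (part_wt (part b)) else 0)) //; last 2 first.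
- move=> b; have := part_mem b.
  by rewrite mem_parts connected_partE -ht_eq0 -lt0n => /andP [_ /andP []].
- move=> b [|d]; first by rewrite mul0r big_geq.
  rewrite big_ltn // eqxx subSS subn0 big_nat big1 ?addr0 => [|l /andP [l1 _]]; last first.
    by rewrite ifN ?mul0r // gtn_eqF.
  have dN : d.+1%:R != 0 :> rat by rewrite pnatr_eq0.
  have fN : (d`!)%:R != 0 :> rat by rewrite pnatr_eq0 -lt0n fact_gt0.
  rewrite /part_coef exprS factS natrM.
  move: (d.+1%:R) (d`!%:R) dN fN => u v dN fN; field; by rewrite dN fN.
transitivity (\sum_(b : 'I_(size (parts N)))
   (ht (part_wt (part b)))%:R * (x * chrmult K e (part_wt (part b))) *
     shift (part_wt (part b)) (bond_sum x) m).
  apply: eq_bigr => b _; rewrite big_ltn // big_nat big1 ?addr0 => [|l /andP [l1 _]]; last first.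
    by rewrite ifN ?mulr0 ?mul0r // gtn_eqF.
  rewrite mulr1n eqxx; congr (_ * _); rewrite /shift; case: ifP => // _.
  rewrite -/(bond_series x N) -bond_sumE //; apply: leq_ltn_trans mN; apply: wle_ht.
  by apply/wleP => i; rewrite ffunE leq_subr.
pose F a := chr_coef K e a * shift a (bond_sum x) m.
transitivity (x * \sum_(a <- part_wts N) F a).
  transitivity (x * \sum_(P <- parts N) F (part_wt P)).
    rewrite [in RHS]big_tnth mulr_sumr; apply: eq_bigr => b _.
    by rewrite /F /chr_coef -!mulrA mulrCA.
  by congr (_ * _); rewrite big_map; apply: eq_bigr => a _; rewrite mset_of_wtK.
congr (_ * _); rewrite /conv.
transitivity (\sum_(a <- below m | connected_part e (mset_of_wt a)) F a).
  rewrite (bigID (fun a => wle a m)) /= [X in _ + X]big1 ?addr0 => [|a am]; last first.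
    by rewrite /F /shift (negbTE am) mulr0.
  rewrite -[LHS]big_filter -[RHS]big_filter; apply: perm_big; apply: uniq_perm;
    try exact/filter_uniq/filter_uniq/below_uniq.
    exact/filter_uniq/below_uniq.
  move=> a; rewrite mem_filter mem_part_wts [RHS]mem_filter mem_below.
  case: (boolP (wle a m)) => [am|]; last by rewrite andbF.
  by rewrite (leq_ltn_trans (wle_ht am) mN) andbT.
(* The restriction to connected parts can be lifted: the coefficient vanishes at a = 0 through its
   factor ht a, and at disconnected weights because the Lie algebra does. *)
rewrite big_mkcond big_seq [RHS]big_seq; apply: eq_bigr => a; rewrite mem_below => am.
rewrite /F /shift am; case: ifP => // /negbT; rewrite connected_partE mset_of_wtK negb_and negbK.
case/orP => [/eqP ->|ca]; first by rewrite /chr_coef ht0 !mul0r.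
by rewrite chr_coef_disconnected ?mul0r.
Qed.

End BondSeries.

(** * Comparison of bonds and colorings *)

Section BondRecursion.
Variables (K : numFieldType) (n : nat) (e : rel 'I_n).
Hypotheses (e_sym : symmetric e) (e_irr : irreflexive e).
Implicit Types m : {ffun 'I_n -> nat}.

Lemma setpow0 q : setpow (signed_indep e) q 0 = 1.
Proof.
elim: q => [|q IH]; first by rewrite /setpow /= eqxx.
rewrite -[LHS]/(setop _ (setpow _ q) 0) /setop (bigD1 set0) //= big1 ?addr0 => [|S S0].
  have -> : signed_indep e set0 = 1.
    rewrite /signed_indep cards0 mulr1 (_ : indep e set0) //.
    by apply/indepP => x y; rewrite inE.
  rewrite mul1r /shift ifT; last by apply/wleP => i; rewrite ffunE inE.
  by rewrite (_ : wsub 0 _ = 0) //; apply/ffunP => i; rewrite !ffunE sub0n.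
rewrite /shift ifN ?mulr0 //; apply: contra S0 => /wle_ht.
by rewrite ht_ind ht0 leqn0 cards_eq0.
Qed.

(** The common recursion determines the value at m from smaller weights: ht m is invertible for
    nonzero m, and the term a = 0, which would involve m itself, has coefficient 0. *)
Lemma bond_sum_setpow q m : bond_sum K e (- q%:R) m = setpow (signed_indep e) q m.
Proof.
have ch : setop (signed_indep e) (fun m => (size (traces e m))%:R) = fun m => (m == 0)%:R.
  apply: funext => m'; rewrite -(cartier_foata e_sym e_irr) big_mkcond.
  apply: eq_bigr => S _; rewrite /signed_indep /shift.
  by case: (indep e S); case: (wle _ _); rewrite /= ?mul0r ?mulr0 ?mul1r.
have eh : euler (fun m => (size (traces e m))%:R : rat) =
    conv (chr_coef K e) (fun m => (size (traces e m))%:R).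
  by apply: funext => m'; apply: traces_rec.
have [d] := ubnP (ht m); elim: d m => // d IH m; rewrite ltnS => md.
have [->|m0] := eqVneq m 0; first by rewrite bond_sum0 setpow0.
have h0 : (ht m)%:R != 0 :> rat by rewrite pnatr_eq0 ht_eq0.
apply: (mulfI h0); rewrite bond_sum_rec // -[RHS]/(euler _ m) (euler_setpow ch eh).
congr (_ * _); apply: eq_big_seq => a; rewrite mem_below => am.
have [->|a0] := eqVneq a 0; first by rewrite /chr_coef ht0 !mul0r.
rewrite IH //; apply: leq_trans md.
by rewrite -{2}(wsubK am) htD -addn1 leq_add2l lt0n ht_eq0.
Qed.
End BondRecursion.

Theorem theorem1p2 (R : realType) (n : nat) (e : rel 'I_n)
    (e_sym : symmetric e) (e_irr : irreflexive e) (k : {ffun 'I_n -> nat}) :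
  gchrom_poly_tilde e k =
  \sum_(J \in bond_lattice e k)
    chrmult_bond e R[i] J *: 'X^(size (J : {mset {mset 'I_n}})).
Proof.
set rhs := RHS.
have rhsE q : rhs.[- q%:R] = (-1) ^+ ht k * #|multicoloring e k q|%:R.
  rewrite multicoloring_setpow -(bond_sum_setpow (R[i] : numFieldType) e_sym e_irr) /bond_sum /rhs.
  rewrite !fsbig_finite ?horner_sum; try exact: bond_lattice_finite.
  by apply: eq_bigr => J _; rewrite hornerZ hornerXn.
(* The sign and the substitution of -q for q are involutions, so the claim amounts to identifying
   the twisted right-hand side with [gchrom_poly], which is determined by its values at positive
   integers. *)
rewrite /gchrom_poly_tilde -(@gchrom_poly_unique _ _ _ ((-1) ^+ ht k *: (rhs \Po (- 'X)))).
  rewrite comp_polyZ scalerA -exprMn mulrNN mulr1 expr1n scale1r.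
  by rewrite -comp_polyA raddfN /= comp_polyX opprK comp_polyXr.
move=> q _; rewrite hornerZ horner_comp hornerN hornerX rhsE.
by rewrite mulrA -exprMn mulrNN mulr1 expr1n mul1r.
Qed.
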